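(* Let $v_t=D_x\big(\mathbf E(H_1(x,v,v_x,\dots))\big)$ be a Hamiltonian evolution equation, with potential form $$u_t=\mathbf E(H_1)\big|_{v=u_x}.$$ Let $\mathcal D_0$ be a second time independent Hamiltonian operator with Hamiltonian $H_0(x,v,v_x,\dots)$ satisfying $D_x(\mathbf E(H_1))=\mathcal D_0(\mathbf E(H_0))$, and assume that there is a function $H_2(x,v,v_x,\dots)$ with $$\mathcal D_0(\mathbf E(H_1))=D_x(\mathbf E(H_2)).$$ Let $\mathcal E=\mathcal D_0|_{v=u_x}$. Then $$\mathcal E\big(\mathbf E(H_1)|_{v=u_x}\big)=-\mathbf E\big(H_2|_{v=u_x}\big).$$ Furthermore, if $\mathcal E$ is a symplectic operator (in the variable $u$), then $\mathcal E$ is a variational operator for the potential equation $u_t=\mathbf E(H_1)|_{v=u_x}$, and there is a time independent function $Q(x,u,u_x,\dots)$ with $\mathcal E=\mathbf F_Q^*-\mathbf F_Q$ and $$\mathcal E\big(u_t-\mathbf E(H_1)|_{v=u_x}\big)=\mathbf E\big(Q\,u_t+H_2|_{v=u_x}\big).$$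
   Context: $D_x$ denotes the total $x$-derivative in whichever dependent variable ($u$ or $v$) is in use, and $\mathbf E$ the Euler–Lagrange operator: in the variable $v$, $\mathbf E(H)=\sum_i(-D_x)^i(\partial H/\partial v_i)$; in the variable $u$, on $J^\infty(\mathbb R^2,\mathbb R)$, $\mathbf E(L)=\sum_{a,i}(-1)^{a+i}D_x^iD_t^a(\partial L/\partial u_{a,i})$, with $u_{a,i}$ corresponding to $\partial_t^a\partial_x^iu$. All functions are smooth and depend on finitely many derivatives. The notation $|_{v=u_x}$ means substituting $v_i=u_{i+1}$, i.e. $v=u_x,\ v_x=u_{xx},\dots$, in functions or in the coefficients of differential operators $\sum r_iD_x^i$. A Hamiltonian operator is a skew-adjoint differential operator $\mathcal D$ in $D_x$ (coefficients functions of $x,v,v_x,\dots$) whose bracket $\{\int P,\int Q\}=\int\mathbf E(P)\,\mathcal D\,\mathbf E(Q)\,dx$ on functionals satisfies the Jacobi identity. $\mathbf F_Q=\sum_i(\partial Q/\partial u_i)D_x^i$ is the Fréchet derivative and $\mathbf F_Q^*(f)=\sum_i(-D_x)^i\big((\partial Q/\partial u_i)f\big)$ its formal adjoint. Symplectic operator: on $J^\infty(\mathbb R,\mathbb R)$ with coordinates $(x,u,u_1,\dots)$ and $\theta^i=du_i-u_{i+1}dx$, a skew-adjoint operator $\mathcal S=\sum s_i(x,u,u_1,\dots)D_x^i$ is symplectic if $\Sigma=dx\wedge\theta^0\wedge\sum_i s_i\theta^i\neq0$ satisfies $\delta_V\Sigma=0$. Here $\delta_V=I\circ d_V$, $d_V$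 is the anti-derivation with $d_Vf=\sum_i(\partial f/\partial u_i)\theta^i$, $d_V(dx)=0$, $d_V\theta^i=0$, and for $\Sigma$ a sum of terms $f\,dx\wedge\theta^{i_1}\wedge\cdots\wedge\theta^{i_s}$, $I(\Sigma)=\frac1s\theta^0\wedge\sum_i(-D_x)^i(\partial_{u_i}\lrcorner\,\Sigma)$, with $D_x$ acting as a derivation, $D_x(dx)=0$, $D_x\theta^i=\theta^{i+1}$. Variational operator: $\mathcal E=\sum_i r_iD_x^i$ (with $r_i$ functions of $t,x,u,u_x,\dots$ only) is a variational operator for $u_t=F(x,u,u_x,\dots)$ if $\mathcal E(u_t-F)=\mathbf E(L)$ for some $L\in C^\infty(J^\infty(\mathbb R^2,\mathbb R))$. *)

(* Defs.v *)
(* Concrete Stdlib reals with Coquelicot's derivatives. *)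
From Stdlib Require Import Reals List ClassicalEpsilon.
From Coquelicot Require Import Coquelicot.
Import ListNotations.
Open Scope R_scope.

(** * Jet spaces and differential functions *)

(* A jet space is [C -> R] for a type [C] of coordinates; [level c] is the
   number of derivatives taken in the coordinate [c]. *)
Class Coords (C : Type) := {
  coord_eq_dec : forall c d : C, {c = d} + {c <> d};
  level : C -> nat
}.

(* J^oo(R,R): [X] is the independent variable x and [U i] is the i-th x-derivative
   of the dependent variable.  The same space serves for both dependent variables:
   [U i] reads v_i in functions of (x,v,v_x,...), u_i in functions of (x,u,u_x,...). *)
Inductive coord1 : Set := X | U (i : nat).

(* J^oo(R^2,R): [W a i] is u_{a,i}, the coordinate of d_t^a d_x^i u. *)
Inductive coord2 : Set := T2 | X2 | W (a i : nat).

Definition coord1_eq_dec (c d : coord1) : {c = d} + {c <> d}.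
Proof. decide equality; apply PeanoNat.Nat.eq_dec. Defined.

Definition coord2_eq_dec (c d : coord2) : {c = d} + {c <> d}.
Proof. decide equality; apply PeanoNat.Nat.eq_dec. Defined.

#[export] Instance Coords1 : Coords coord1 := {
  coord_eq_dec := coord1_eq_dec;
  level := fun c => match c with X => 0%nat | U i => i end
}.

#[export] Instance Coords2 : Coords coord2 := {
  coord_eq_dec := coord2_eq_dec;
  level := fun c => match c with T2 => 0%nat | X2 => 0%nat | W a i => (a + i)%nat end
}.

Definition jet (C : Type) : Type := C -> R.
Definition jfun (C : Type) : Type := jet C -> R.

Section Generic.
Context {C : Type} {HC : Coords C}.

Definition upd (p : jet C) (c : C) (s : R) : jet C :=
  fun d => if coord_eq_dec d c then s else p d.

Definition partial (c : C) (f : jfun C) : jfun C :=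
  fun p => Derive (fun s => f (upd p c s)) (p c).

Definition partials (l : list C) (f : jfun C) : jfun C := fold_right partial f l.

(* [fct_UniformSpace] carries the sup topology; for functions of finitely many
   coordinates, the only ones considered, continuity is the usual
   finite-dimensional one, so this is C^oo. *)
Definition smooth (f : jfun C) : Prop :=
  forall (l : list C) (p : jet C),
    @continuous (fct_UniformSpace C R_UniformSpace) R_UniformSpace (partials l f) p /\
    forall c : C, ex_derive (fun s => partials l f (upd p c s)) (p c).

Definition order_le (n : nat) (f : jfun C) : Prop :=
  forall p q : jet C, (forall c, (level c <= n)%nat -> p c = q c) -> f p = f q.

Definition dfun (f : jfun C) : Prop := smooth f /\ exists n, order_le n f.

(* Some bound on the order of [f]: it only serves to truncate sums over all jet
   coordinates, whose terms vanish beyond any such bound. *)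
Definition ord (f : jfun C) : nat := epsilon (inhabits 0%nat) (fun n => order_le n f).

Definition fopp (f : jfun C) : jfun C := fun p => - f p.

(** * Differential operators *)

(* [r_0 + r_1 D + ... + r_n D^n] with [n = op_order]; the values of [op_coef]
   above [n] are irrelevant. *)
Record dop := DOp { op_order : nat; op_coef : nat -> jfun C }.

Definition dop_wf (A : dop) : Prop :=
  forall i, (i <= op_order A)%nat -> dfun (op_coef A i).

(* [D] is the total x-derivative of the jet space. *)
Definition op_apply (D : jfun C -> jfun C) (A : dop) (f : jfun C) : jfun C :=
  fun p => sum_f_R0 (fun i => op_coef A i p * Nat.iter i D f p) (op_order A).

Definition op_adjoint (D : jfun C -> jfun C) (A : dop) (f : jfun C) : jfun C :=
  fun p => sum_f_R0
    (fun i => Nat.iter i (fun g => fopp (D g)) (fun q => op_coef A i q * f q) p)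
    (op_order A).

End Generic.

Arguments dop : clear implicits.

(** * Total derivatives, Euler operators, Frechet derivative *)

Definition TDx (f : jfun coord1) : jfun coord1 :=
  fun p => partial X f p + sum_f_R0 (fun i => p (U (S i)) * partial (U i) f p) (ord f).

Definition TDx2 (f : jfun coord2) : jfun coord2 :=
  fun p => partial X2 f p +
    sum_f_R0 (fun a => sum_f_R0 (fun i => p (W a (S i)) * partial (W a i) f p) (ord f))
      (ord f).

Definition TDt2 (f : jfun coord2) : jfun coord2 :=
  fun p => partial T2 f p +
    sum_f_R0 (fun a => sum_f_R0 (fun i => p (W (S a) i) * partial (W a i) f p) (ord f))
      (ord f).

Definition mTDx (f : jfun coord1) : jfun coord1 := fopp (TDx f).
Definition mTDx2 (f : jfun coord2) : jfun coord2 := fopp (TDx2 f).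
Definition mTDt2 (f : jfun coord2) : jfun coord2 := fopp (TDt2 f).

Definition Euler (H : jfun coord1) : jfun coord1 :=
  fun p => sum_f_R0 (fun i => Nat.iter i mTDx (partial (U i) H) p) (ord H).

Definition Euler2 (L : jfun coord2) : jfun coord2 :=
  fun p => sum_f_R0 (fun a => sum_f_R0 (fun i =>
    Nat.iter i mTDx2 (Nat.iter a mTDt2 (partial (W a i) L)) p) (ord L)) (ord L).

Definition frechet (Q : jfun coord1) : dop coord1 :=
  DOp (ord Q) (fun i => partial (U i) Q).

(** * The substitution v = u_x, and pullback to J^oo(R^2,R) *)

Definition subst_ux (f : jfun coord1) : jfun coord1 :=
  fun p => f (fun c => match c with X => p X | U i => p (U (S i)) end).

Definition op_subst_ux (A : dop coord1) : dop coord1 :=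
  DOp (op_order A) (fun i => subst_ux (op_coef A i)).

Definition lift (f : jfun coord1) : jfun coord2 :=
  fun p => f (fun c => match c with X => p X2 | U i => p (W 0 i) end).

Definition op_lift (A : dop coord1) : dop coord2 :=
  DOp (op_order A) (fun i => lift (op_coef A i)).

Definition u_t : jfun coord2 := fun p => p (W 1 0).

(** * Hamiltonian operators *)

Definition skew_adjoint (A : dop coord1) : Prop :=
  forall f, dfun f -> forall p, op_adjoint TDx A f p = - op_apply TDx A f p.

(* Density of the bracket of the functionals int P and int Q. *)
Definition bracket (A : dop coord1) (P Q : jfun coord1) : jfun coord1 :=
  fun p => Euler P p * op_apply TDx A (Euler Q) p.

(* A functional is a density modulo total x-derivatives. *)
Definition jacobi (A : dop coord1) : Prop :=
  forall P Q R', dfun P -> dfun Q -> dfun R' ->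
  exists V, dfun V /\ forall p,
    bracket A (bracket A P Q) R' p + bracket A (bracket A Q R') P p
    + bracket A (bracket A R' P) Q p = TDx V p.

Definition hamiltonian_op (A : dop coord1) : Prop :=
  dop_wf A /\ skew_adjoint A /\ jacobi A.

(** * Forms on J^oo(R,R) and symplectic operators *)

Inductive cogen : Set := dx | theta (i : nat).

Definition cogen_eq_dec (g h : cogen) : {g = h} + {g <> h}.
Proof. decide equality; apply PeanoNat.Nat.eq_dec. Defined.

(* A form is a finite formal sum of terms [f . g_1 /\ ... /\ g_k]; two such sums
   are the same form when their difference satisfies [form_zero] below. *)
Definition form : Type := list (jfun coord1 * list cogen).

Definition form_scale (k : R) (w : form) : form :=
  map (fun m => (fun p => k * fst m p, snd m)) w.

Definition wedge_l (g : cogen) (w : form) : form :=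
  map (fun m => (fst m, g :: snd m)) w.

(* Signed terms of the interior product of [g_1 /\ ... /\ g_k] with the vector dual
   to [g] in the coframe (dx, theta^i); it is an antiderivation. *)
Fixpoint contract_word (g : cogen) (l : list cogen) : list (R * list cogen) :=
  match l with
  | [] => []
  | h :: l' =>
      (if cogen_eq_dec h g then [(1, l')] else []) ++
      map (fun m => (- fst m, h :: snd m)) (contract_word g l')
  end.

(* [contract (theta k)] is the interior product with d/du_k; [contract dx] is the
   one with the total derivative vector field D_x. *)
Definition contract (g : cogen) (w : form) : form :=
  flat_map (fun m =>
    map (fun n => (fun p => fst n * fst m p, snd n)) (contract_word g (snd m))) w.

(* A form vanishes iff it vanishes on all tuples of vectors of the dual frame. *)
Definition scalar_part (w : form) : jfun coord1 :=
  fun p => fold_right Rplus 0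
    (map (fun m => match snd m with [] => fst m p | _ => 0 end) w).

Definition form_zero (w : form) : Prop :=
  forall (gs : list cogen) (p : jet coord1), scalar_part (fold_right contract w gs) p = 0.

(* d_V f = sum_j (df/du_j) theta^j, and d_V kills dx and the theta^i. *)
Definition dV (w : form) : form :=
  flat_map (fun m =>
    map (fun j => (partial (U j) (fst m), theta j :: snd m))
      (seq 0 (S (ord (fst m))))) w.

Definition Dx_cogen (g : cogen) : list cogen :=
  match g with dx => [] | theta i => [theta (S i)] end.

(* The words of the Leibniz expansion of D_x(g_1 /\ ... /\ g_k). *)
Fixpoint Dx_word (l : list cogen) : list (list cogen) :=
  match l with
  | [] => []
  | h :: l' => map (fun h' => h' :: l') (Dx_cogen h) ++ map (cons h) (Dx_word l')
  end.

Definition Dx_form (w : form) : form :=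
  flat_map (fun m =>
    (TDx (fst m), snd m) :: map (fun l => (fst m, l)) (Dx_word (snd m))) w.

(* A bound on the indices i of the theta^i occurring in [w]; the interior product
   with d/du_i vanishes on [w] for larger i. *)
Definition theta_bound (w : form) : nat :=
  list_max (flat_map (fun m =>
    map (fun g => match g with dx => 0%nat | theta i => i end) (snd m)) w).

(* The operator I on forms with [s] factors theta. *)
Definition interior_euler (s : nat) (w : form) : form :=
  form_scale (/ INR s) (wedge_l (theta 0)
    (flat_map (fun i =>
       Nat.iter i (fun eta => form_scale (-1) (Dx_form eta)) (contract (theta i) w))
     (seq 0 (S (theta_bound w))))).

(* On forms with [s] factors theta. *)
Definition deltaV (s : nat) (w : form) : form := interior_euler (S s) (dV w).

Definition op_form (A : dop coord1) : form :=
  map (fun i => (op_coef A i, [dx; theta 0; theta i])) (seq 0 (S (op_order A))).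

Definition symplectic_op (A : dop coord1) : Prop :=
  dop_wf A /\ skew_adjoint A /\
  ~ form_zero (op_form A) /\ form_zero (deltaV 2 (op_form A)).

(** * Variational operators *)

Definition no_t_derivatives (f : jfun coord2) : Prop :=
  forall p q : jet coord2,
    p T2 = q T2 -> p X2 = q X2 -> (forall i, p (W 0 i) = q (W 0 i)) -> f p = f q.

(* [A] is a variational operator for u_t = F(x,u,u_x,...). *)
Definition variational_op (A : dop coord2) (F : jfun coord1) : Prop :=
  dop_wf A /\
  (forall i, (i <= op_order A)%nat -> no_t_derivatives (op_coef A i)) /\
  exists L : jfun coord2, dfun L /\
    forall p, op_apply TDx2 A (fun q => u_t q - lift F q) p = Euler2 L p.

(* Main.v *)
Require Import Defs.
From Stdlib Require Import Reals List Lia Lra ClassicalEpsilon FunctionalExtensionality FinFun.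
From Coquelicot Require Import Coquelicot.
Import ListNotations.
Open Scope R_scope.

(** Write [A] for the operator obtained from [D0] by the substitution v = u_x, and [F] for the
    right-hand side of the potential equation.

    The first identity is a matter of shifting indices. A function of (x, u_x, u_xx, ...) has
    as its derivative in u_(i+1) the derivative of the original function in v_i, so every
    summand of its Euler expression carries one more factor -D_x, and the Euler expression is
    -D_x of the substituted one ([Euler_subst]). Substitution commutes with D_x, hence the
    relation between H1 and H2 turns into the claim ([potential_gradient]).

    The potential Q comes from a Poincare lemma for the variational complex. Evaluate
    delta_V of the symplectic form on three evolutionary fields and on D_x: modulo total
    derivatives the interior Euler operator does nothing, so the alternating sum of the terms
    g M_f(h), where M_f is the operator whose coefficients are those of [A] varied along f, is
    a null Lagrangian ([closed_null]). The operators M_f are skew-adjoint because [A] is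
    ([var_op_skew]), which makes it possible to free one argument from all derivatives. It can
    then be cancelled, since only the zero function has null multiples throughout
    ([null_multiples_zero]), and a pointwise operator identity is left ([closed_adjoint]).
    With the dependent variable u in place of the third argument and K = A(u), it says
    that the Frechet derivative of K minus its adjoint is 2A + Y(A), where Y is the Euler
    scaling field of the fibre ([closed_coefs]). Since l (2A + Y(A)) at (x, l u) is the
    derivative in l of l^2 A(x, l u), integration over 0 <= l <= 1 gives back [A]; the
    integral commutes with D_x, hence with adjoints, so that Q = - int_0^1 K(x, l u) dl has
    the required property ([potential_coefs]). Coefficients rather than operators are compared
    because the identity has to be integrated coefficient by coefficient and then read again
    on the jets of two independent variables.

    There, the Lagrangian Q u_t + H2 has Euler expression F_Q^*(u_t) - D_t Q plus that of H2,
    and D_t Q = F_Q(u_t) ([Euler2_lagrangian]). The first part is A(u_t), and the second is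
    - A(F) by the first identity.

    All derivatives that occur (partial and total derivatives, evolutionary fields, the
    scaling field) are derivations along vector fields on the jet space; the chain rule
    [chain_rule] reduces their algebra to that of directional derivatives. *)

(** * Finite sums *)

Definition lsum {A : Type} (l : list A) (F : A -> R) : R :=
  fold_right Rplus 0 (map F l).

Lemma lsum_ext {A} (l : list A) F G :
  (forall a, In a l -> F a = G a) -> lsum l F = lsum l G.
Proof.
  unfold lsum; intros H; induction l as [|a l IH]; simpl; [easy|].
  rewrite H by (now left); rewrite IH; [easy|]. intros; apply H; now right.
Qed.

Lemma lsum_plus {A} (l : list A) F G :
  lsum l (fun a => F a + G a) = lsum l F + lsum l G.
Proof. unfold lsum; induction l; simpl; [lra|]; rewrite IHl; ring. Qed.

Lemma lsum_scal {A} (l : list A) k F :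
  lsum l (fun a => k * F a) = k * lsum l F.
Proof. unfold lsum; induction l; simpl; [lra|]; rewrite IHl; ring. Qed.

Lemma lsum_zero {A} (l : list A) F : (forall a, In a l -> F a = 0) -> lsum l F = 0.
Proof.
  intros H; rewrite (lsum_ext l F (fun _ => 0 * 0)).
  - rewrite lsum_scal; ring.
  - intros; rewrite H by easy; ring.
Qed.

Lemma lsum_swap {A B} (l : list A) (m : list B) F :
  lsum l (fun a => lsum m (fun b => F a b)) = lsum m (fun b => lsum l (fun a => F a b)).
Proof.
  induction l as [|a l IH].
  - symmetry; apply lsum_zero; reflexivity.
  - change (lsum m (F a) + lsum l (fun a => lsum m (fun b => F a b))
      = lsum m (fun b => F a b + lsum l (fun a => F a b))).
    rewrite IH, lsum_plus; reflexivity.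
Qed.

Lemma lsum_app {A} (l m : list A) F : lsum (l ++ m) F = lsum l F + lsum m F.
Proof. unfold lsum; induction l; simpl; [lra|]; rewrite IHl; ring. Qed.

Lemma lsum_map {A B} (h : A -> B) (l : list A) F : lsum (map h l) F = lsum l (fun a => F (h a)).
Proof. unfold lsum; rewrite map_map; reflexivity. Qed.

Lemma lsum_flat_map {A B} (h : A -> list B) (l : list A) F :
  lsum (flat_map h l) F = lsum l (fun a => lsum (h a) F).
Proof. induction l; simpl; [easy|]. rewrite lsum_app, IHl; reflexivity. Qed.

Lemma lsum_seq n F : lsum (seq 0 (S n)) F = sum_f_R0 F n.
Proof.
  induction n; [unfold lsum; simpl; ring|].
  rewrite seq_S, lsum_app, IHn; unfold lsum; simpl; ring.
Qed.

(** * Smooth functions on jet spaces *)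

Section Jets.
Context {C : Type} {HC : Coords C}.

Implicit Types (f g : jfun C) (p q : jet C) (c d : C).

Definition fconst (k : R) : jfun C := fun _ => k.
Definition fcoord (c : C) : jfun C := fun p => p c.
Definition fadd f g : jfun C := fun p => f p + g p.
Definition fmul f g : jfun C := fun p => f p * g p.
Definition fsum (F : nat -> jfun C) (n : nat) : jfun C := fun p => sum_f_R0 (fun i => F i p) n.

Lemma upd_same p c s : upd p c s c = s.
Proof. unfold upd; destruct (coord_eq_dec c c); easy. Qed.

Lemma upd_other p c d s : d <> c -> upd p c s d = p d.
Proof. unfold upd; destruct (coord_eq_dec d c); easy. Qed.

Lemma upd_upd p c s t : upd (upd p c s) c t = upd p c t.
Proof. apply functional_extensionality; intros d; unfold upd; destruct coord_eq_dec; easy. Qed.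

Lemma upd_self p c : upd p c (p c) = p.
Proof.
  apply functional_extensionality; intros d; unfold upd; destruct coord_eq_dec; congruence.
Qed.

Lemma upd_comm p c d s t : c <> d -> upd (upd p c s) d t = upd (upd p d t) c s.
Proof.
  intros H; apply functional_extensionality; intros e; unfold upd.
  destruct (coord_eq_dec e d), (coord_eq_dec e c); congruence.
Qed.

Notation jcont f p := (@continuous (fct_UniformSpace C R_UniformSpace) R_UniformSpace f p).

Lemma jcont_eps f p :
  jcont f p <-> forall e : posreal, exists del : posreal, forall q,
    (forall c, Rabs (q c - p c) < del) -> Rabs (f q - f p) < e.
Proof.
  split.
  - intros H e.
    destruct (H (ball (f p) e) (locally_ball _ e)) as [del Hd].
    exists del; intros q Hq; apply (Hd q); intros c; apply Hq.
  - intros H P [e He]. destruct (H e) as [del Hd].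
    exists del; intros q Hq; apply He, Hd; intros c; apply Hq.
Qed.

Definition ex_partial c f : Prop := forall p, ex_derive (fun s => f (upd p c s)) (p c).

(** The definition of [smooth] lists all iterated partial derivatives at once; peeling them off
    one at a time is what closure under products, renamings and parameter integrals needs. *)
Fixpoint Ck (k : nat) f : Prop :=
  (forall p, jcont f p) /\
  match k with
  | 0%nat => True
  | S k' => forall c, ex_partial c f /\ Ck k' (partial c f)
  end.

Lemma partials_snoc l c f : partials l (partial c f) = partials (l ++ [c]) f.
Proof. unfold partials; rewrite fold_right_app; reflexivity. Qed.

Lemma smooth_partial c f : smooth f -> smooth (partial c f).
Proof. intros H l p; rewrite partials_snoc; apply H. Qed.

Lemma smooth_cont f p : smooth f -> jcont f p.
Proof. intros H; apply (proj1 (H nil p)). Qed.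

Lemma smooth_ex_partial c f : smooth f -> ex_partial c f.
Proof. intros H p; apply (proj2 (H nil p)). Qed.

Lemma smooth_Ck f : smooth f <-> forall k, Ck k f.
Proof.
  split.
  - intros H k; revert f H; induction k; intros f H; simpl.
    + split; [intros p; now apply smooth_cont | easy].
    + split; [intros p; now apply smooth_cont |].
      intros c; split; [now apply smooth_ex_partial | apply IHk; now apply smooth_partial].
  - intros H.
    assert (Hl : forall l k, Ck k (partials l f)).
    { induction l as [|c l IH]; intros k; simpl; [apply H|].
      destruct (IH (S k)) as [_ Hk]; apply (proj2 (Hk c)). }
    intros l p; split.
    + apply (proj1 (Hl l 0%nat)).
    + intros c; apply (proj1 (proj2 (Hl l 1%nat) c)).
Qed.

Lemma Ck_down k f : Ck (S k) f -> Ck k f.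
Proof.
  revert f; induction k; intros f [H0 H]; (split; [exact H0|]); [exact I|].
  intros c; destruct (H c) as [H1 H2]; split; [exact H1 | exact (IHk _ H2)].
Qed.

Lemma ex_partial_at c f : ex_partial c f ->
  forall p s, ex_derive (fun s => f (upd p c s)) s.
Proof.
  intros H p s; specialize (H (upd p c s)); rewrite upd_same in H.
  eapply ex_derive_ext; [|exact H]; intros t; simpl; now rewrite upd_upd.
Qed.

Lemma is_derive_partial c f : ex_partial c f ->
  forall p s, is_derive (fun s => f (upd p c s)) s (partial c f (upd p c s)).
Proof.
  intros H p s; unfold partial; rewrite upd_same.
  rewrite (Derive_ext _ (fun t => f (upd p c t))) by (intros; now rewrite upd_upd).
  apply Derive_correct, ex_partial_at, H.
Qed.

Lemma partial_unique c f p l :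
  is_derive (fun s => f (upd p c s)) (p c) l -> partial c f p = l.
Proof. apply is_derive_unique. Qed.

Lemma partial_const c k : partial c (fconst k) = fconst 0.
Proof.
  apply functional_extensionality; intros p; apply partial_unique; apply (is_derive_const k).
Qed.

Lemma partial_add c f g : ex_partial c f -> ex_partial c g ->
  partial c (fadd f g) = fadd (partial c f) (partial c g).
Proof.
  intros Hf Hg; apply functional_extensionality; intros p.
  apply (Derive_plus (fun s => f (upd p c s)) (fun s => g (upd p c s))); [apply Hf | apply Hg].
Qed.

Lemma partial_mul c f g : ex_partial c f -> ex_partial c g ->
  partial c (fmul f g) = fadd (fmul (partial c f) g) (fmul f (partial c g)).
Proof.
  intros Hf Hg; apply functional_extensionality; intros p.
  unfold partial, fmul, fadd.
  rewrite (Derive_mult (fun s => f (upd p c s)) (fun s => g (upd p c s)));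
    [|apply Hf|apply Hg].
  now rewrite upd_self.
Qed.

Lemma ex_partial_add c f g : ex_partial c f -> ex_partial c g -> ex_partial c (fadd f g).
Proof.
  intros Hf Hg p.
  apply (ex_derive_plus (fun s => f (upd p c s)) (fun s => g (upd p c s))); auto.
Qed.

Lemma ex_partial_mul c f g : ex_partial c f -> ex_partial c g -> ex_partial c (fmul f g).
Proof.
  intros Hf Hg p.
  apply (ex_derive_mult (fun s => f (upd p c s)) (fun s => g (upd p c s))); auto.
Qed.

Lemma jcont_add f g p : jcont f p -> jcont g p -> jcont (fadd f g) p.
Proof. intros Hf Hg; apply (continuous_plus (V := R_NormedModule) _ _ _ Hf Hg). Qed.

Lemma jcont_mul f g p : jcont f p -> jcont g p -> jcont (fmul f g) p.
Proof. intros Hf Hg; apply (continuous_mult (K := R_AbsRing) _ _ _ Hf Hg). Qed.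

Lemma Ck_const n k : Ck n (fconst k).
Proof.
  revert k; induction n; intros k; (split; [intros p; apply continuous_const|]); [exact I|].
  intros c; rewrite partial_const; split; [intros p; exists 0; apply (is_derive_const k) | exact (IHn 0)].
Qed.

Lemma Ck_add n f g : Ck n f -> Ck n g -> Ck n (fadd f g).
Proof.
  revert f g; induction n; intros f g [Hf Hf'] [Hg Hg'];
    (split; [intros p; now apply jcont_add|]); [exact I|].
  intros c; destruct (Hf' c), (Hg' c).
  rewrite partial_add by easy; split; [now apply ex_partial_add | apply IHn; assumption].
Qed.

Lemma Ck_mul n f g : Ck n f -> Ck n g -> Ck n (fmul f g).
Proof.
  revert f g; induction n; intros f g Hf Hg;
    (split; [intros p; apply jcont_mul; [apply Hf|apply Hg]|]); [exact I|].
  intros c; destruct (proj2 Hf c), (proj2 Hg c).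
  apply Ck_down in Hf; apply Ck_down in Hg.
  rewrite partial_mul by easy; split; [now apply ex_partial_mul |].
  apply Ck_add; apply IHn; assumption.
Qed.

Lemma is_derive_upd_coord p c d s :
  is_derive (fun s => upd p c s d) s (if coord_eq_dec d c then 1 else 0).
Proof.
  unfold upd; destruct coord_eq_dec; [apply (is_derive_id (K := R_AbsRing)) | apply (is_derive_const (p d))].
Qed.

Lemma partial_coord c d :
  partial c (fcoord d) = fconst (if coord_eq_dec d c then 1 else 0).
Proof. apply functional_extensionality; intros p; apply partial_unique, is_derive_upd_coord. Qed.

Lemma Ck_coord n d : Ck n (fcoord d).
Proof.
  destruct n; (split; [intros p; apply jcont_eps; intros e; exists e; intros q Hq; apply Hq|]);
    [exact I|].
  intros c; split.
  - intros p; eexists; apply is_derive_upd_coord.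
  - rewrite partial_coord; apply Ck_const.
Qed.

(** * Differential functions *)

Lemma order_le_mono n m f : (n <= m)%nat -> order_le n f -> order_le m f.
Proof. intros Hnm H p q Hpq; apply H; intros; apply Hpq; lia. Qed.

Lemma order_le_partial n c f : order_le n f -> order_le n (partial c f).
Proof.
  intros H p q Hpq; unfold partial.
  assert (Hs : forall s, f (upd p c s) = f (upd q c s)).
  { intros s; apply H; intros d Hd; unfold upd; destruct coord_eq_dec; auto. }
  rewrite (Derive_ext _ _ _ Hs).
  destruct (Compare_dec.le_dec (level c) n) as [Hc|Hc]; [now rewrite Hpq|].
  assert (Hk : forall s, f (upd q c s) = f q).
  { intros s; apply H; intros d Hd; apply upd_other; congruence. }
  rewrite !(Derive_ext _ (fun _ => f q) _ Hk), !Derive_const; reflexivity.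
Qed.

Lemma partial_above n c f : order_le n f -> (n < level c)%nat -> partial c f = fconst 0.
Proof.
  intros H Hc; apply functional_extensionality; intros p; unfold partial, fconst.
  rewrite (Derive_ext _ (fun _ => f p)); [apply Derive_const|].
  intros s; apply H; intros d Hd; apply upd_other; intros ->; lia.
Qed.

Lemma order_le_ord f : dfun f -> order_le (ord f) f.
Proof. intros [_ H]; unfold ord; apply epsilon_spec, H. Qed.

Lemma dfun_const k : dfun (fconst k).
Proof. split; [apply smooth_Ck; intros; apply Ck_const | exists 0%nat; easy]. Qed.

Lemma dfun_coord c : dfun (fcoord c).
Proof.
  split; [apply smooth_Ck; intros; apply Ck_coord | exists (level c); intros p q H; now apply H].
Qed.

Lemma order_le_add n f g : order_le n f -> order_le n g -> order_le n (fadd f g).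
Proof. intros Hf Hg p q H; unfold fadd; now rewrite (Hf p q), (Hg p q). Qed.

Lemma order_le_mul n f g : order_le n f -> order_le n g -> order_le n (fmul f g).
Proof. intros Hf Hg p q H; unfold fmul; now rewrite (Hf p q), (Hg p q). Qed.

Lemma common_order f g : dfun f -> dfun g -> exists n, order_le n f /\ order_le n g.
Proof.
  intros [_ [n Hn]] [_ [m Hm]]; exists (Nat.max n m); split.
  - apply (order_le_mono n); [lia | easy].
  - apply (order_le_mono m); [lia | easy].
Qed.

Lemma dfun_add f g : dfun f -> dfun g -> dfun (fadd f g).
Proof.
  intros Hf Hg; destruct (common_order f g Hf Hg) as [n [Hn Hm]]; split.
  - destruct Hf as [Hf _], Hg as [Hg _].
    rewrite smooth_Ck in *; intros k; now apply Ck_add.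
  - exists n; now apply order_le_add.
Qed.

Lemma dfun_mul f g : dfun f -> dfun g -> dfun (fmul f g).
Proof.
  intros Hf Hg; destruct (common_order f g Hf Hg) as [n [Hn Hm]]; split.
  - destruct Hf as [Hf _], Hg as [Hg _].
    rewrite smooth_Ck in *; intros k; now apply Ck_mul.
  - exists n; now apply order_le_mul.
Qed.

Lemma fopp_mul f : fopp f = fmul (fconst (-1)) f.
Proof. apply functional_extensionality; intros p; unfold fopp, fmul, fconst; ring. Qed.

Lemma dfun_opp f : dfun f -> dfun (fopp f).
Proof. intros H; rewrite fopp_mul; apply dfun_mul; [apply dfun_const | easy]. Qed.

Lemma dfun_partial c f : dfun f -> dfun (partial c f).
Proof.
  intros [H [n Hn]]; split; [now apply smooth_partial | exists n; now apply order_le_partial].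
Qed.

Lemma dfun_ex_partial c f : dfun f -> ex_partial c f.
Proof. intros [H _]; now apply smooth_ex_partial. Qed.

Lemma fsum_S F n : fsum F (S n) = fadd (fsum F n) (F (S n)).
Proof. reflexivity. Qed.

Lemma dfun_fsum F n : (forall i, (i <= n)%nat -> dfun (F i)) -> dfun (fsum F n).
Proof.
  induction n; intros H.
  - apply (H 0%nat); lia.
  - rewrite fsum_S; apply dfun_add; [apply IHn; intros; apply H; lia | apply H; lia].
Qed.

(** Schwarz's theorem applies because, in the uniform topology, the jets that differ from [p]
    in two coordinates form a continuous two-parameter family. *)
Lemma partial_comm c d f : dfun f -> partial c (partial d f) = partial d (partial c f).
Proof.
  intros Hf.
  destruct (coord_eq_dec c d) as [<-|Hcd]; [easy|].
  apply functional_extensionality; intros p.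
  pose (F := fun s t => f (upd (upd p c s) d t)).
  assert (F1 : forall s t, Derive (fun z => F s z) t = partial d f (upd (upd p c s) d t)).
  { intros s t; apply is_derive_unique, is_derive_partial, dfun_ex_partial, Hf. }
  assert (F2 : forall s t, Derive (fun z => F z t) s = partial c f (upd (upd p c s) d t)).
  { intros s t; rewrite upd_comm by easy.
    rewrite <- (is_derive_unique _ _ _
      (is_derive_partial c f (dfun_ex_partial c f Hf) (upd p d t) s)).
    apply Derive_ext; intros z; unfold F; now rewrite upd_comm. }
  assert (D12 : forall s t, Derive (fun z => Derive (fun y => F z y) t) s
                       = partial c (partial d f) (upd (upd p c s) d t)).
  { intros s t; rewrite (upd_comm p c d s t) by easy.
    rewrite <- (is_derive_unique _ _ _
      (is_derive_partial c _ (dfun_ex_partial c _ (dfun_partial d f Hf)) (upd p d t) s)).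
    apply Derive_ext; intros z; rewrite F1; now rewrite upd_comm. }
  assert (D21 : forall s t, Derive (fun z => Derive (fun y => F y z) s) t
                       = partial d (partial c f) (upd (upd p c s) d t)).
  { intros s t.
    rewrite <- (is_derive_unique _ _ _
      (is_derive_partial d _ (dfun_ex_partial d _ (dfun_partial c f Hf)) (upd p c s) t)).
    apply Derive_ext; intros z; now rewrite F2. }
  assert (cont : forall g s t, dfun g ->
            continuity_2d_pt (fun u v => g (upd (upd p c u) d v)) s t).
  { intros g s t [Hg _] e.
    destruct (proj1 (jcont_eps g _) (smooth_cont g (upd (upd p c s) d t) Hg) e) as [del Hdel].
    exists del; intros u v Hu Hv; apply Hdel; intros x; unfold upd.
    destruct (coord_eq_dec x d), (coord_eq_dec x c); try easy;
      replace (p x - p x) with 0 by ring; rewrite Rabs_R0; apply del. }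
  pose proof (Schwarz F (p c) (p d)) as HS.
  rewrite D12, D21, (upd_self p c), (upd_self p d) in HS.
  apply HS.
  - exists (mkposreal 1 Rlt_0_1); intros u v _ _; repeat split.
    + eapply ex_derive_ext; [|apply (ex_partial_at c f (dfun_ex_partial c f Hf) (upd p d v) u)].
      intros z; unfold F; simpl; now rewrite upd_comm.
    + apply (ex_partial_at d f (dfun_ex_partial d f Hf) (upd p c u) v).
    + eapply ex_derive_ext;
        [|apply (ex_partial_at c _ (dfun_ex_partial c _ (dfun_partial d f Hf)) (upd p d v) u)].
      intros z; rewrite F1; simpl; now rewrite upd_comm.
    + eapply ex_derive_ext;
        [|apply (ex_partial_at d _ (dfun_ex_partial d _ (dfun_partial c f Hf)) (upd p c u) v)].
      intros z; now rewrite F2.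
  - apply continuity_2d_pt_ext with (2 := cont _ _ _ (dfun_partial c _ (dfun_partial d f Hf))).
    intros; now rewrite D12.
  - apply continuity_2d_pt_ext with (2 := cont _ _ _ (dfun_partial d _ (dfun_partial c f Hf))).
    intros; now rewrite D21.
Qed.

End Jets.

(** * Derivations along vector fields *)

Class FinCoords (C : Type) {HC : Coords C} := {
  coords : nat -> list C;
  coords_NoDup : forall n, NoDup (coords n);
  coords_complete : forall n c, (level c <= n)%nat -> In c (coords n)
}.

Section Lie.
Context {C : Type} {HC : Coords C} {FC : FinCoords C}.

Implicit Types (f g : jfun C) (p q : jet C) (c d : C).

(** A finite-order function only sees finitely many coordinates, so coordinatewise
    continuity of a family of jets is enough, although the jet space itself carries the
    topology of uniform convergence. *)
Lemma continuous_jets (A : UniformSpace) f (Phi : A -> jet C) (a : A) :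
  dfun f -> (forall c, continuous (fun x => Phi x c) a) ->
  continuous (fun x => f (Phi x)) a.
Proof.
  intros [Hf [n Hn]] HPhi P [e HP].
  destruct (proj1 (jcont_eps f _) (smooth_cont f (Phi a) Hf) e) as [del Hdel].
  assert (Hl : forall l : list C,
            locally a (fun x => forall c, In c l -> Rabs (Phi x c - Phi a c) < del)).
  { induction l as [|c l IH].
    - apply filter_forall; intros x c [].
    - assert (Hc : locally a (fun x => Rabs (Phi x c - Phi a c) < del))
        by exact (HPhi c _ (locally_ball (Phi a c) del)).
      generalize (filter_and _ _ IH Hc).
      apply filter_imp; intros x [H1 H2] d [<-|Hd]; auto. }
  unfold filtermap; generalize (Hl (coords n)); apply filter_imp; intros x Hx; apply HP.
  pose (q := fun c => if Compare_dec.le_dec (level c) n then Phi x c else Phi a c).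
  assert (Hq : f q = f (Phi x)).
  { apply Hn; intros c Hc; unfold q; destruct Compare_dec.le_dec; easy. }
  rewrite <- Hq; apply Hdel; intros c; unfold q.
  destruct Compare_dec.le_dec as [Hc|Hc].
  - apply Hx, coords_complete, Hc.
  - rewrite Rminus_diag, Rabs_R0; apply del.
Qed.

Definition setl (l : list C) (r q : jet C) : jet C :=
  fun c => if in_dec coord_eq_dec c l then r c else q c.

Lemma setl_cons c l r q : setl (c :: l) r q = upd (setl l r q) c (r c).
Proof.
  apply functional_extensionality; intros d; unfold setl, upd.
  destruct (coord_eq_dec d c) as [->|Hd].
  - destruct in_dec as [|H]; [easy|]; exfalso; apply H; now left.
  - destruct (in_dec _ d (c :: l)) as [[|H]|H], (in_dec _ d l) as [H'|H'];
      congruence || (exfalso; apply H; now right) || easy.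
Qed.

(** One coordinate of the list is split off at a time, and the two-variable chain rule is
    applied to its value and to the parameter that moves the others. *)
Lemma is_derive_setl f (gam : R -> jet C) t0 (xi : jet C) :
  dfun f -> (forall c, is_derive (fun t => gam t c) t0 (xi c)) ->
  forall l, NoDup l -> forall q,
  is_derive (fun t => f (setl l (gam t) q)) t0
    (lsum l (fun c => xi c * partial c f (setl l (gam t0) q))).
Proof.
  intros Hf Hgam; induction l as [|c l IH]; intros Hl q.
  - apply (is_derive_const (f q)).
  - inversion_clear Hl as [|? ? Hc Hl'].
    pose (G := fun z t => f (upd (setl l (gam t) q) c z)).
    apply (is_derive_ext (fun t => G (gam t c) t)).
    { intros t; unfold G; now rewrite setl_cons. }
    assert (Hset : forall z t, upd (setl l (gam t) q) c z = setl l (gam t) (upd q c z)).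
    { intros z t; apply functional_extensionality; intros d; unfold upd, setl.
      destruct (coord_eq_dec d c) as [->|], (in_dec _ _ l); easy. }
    assert (HG : differentiable_pt_lim G (gam t0 c) t0
              (partial c f (setl (c :: l) (gam t0) q))
              (lsum l (fun d => xi d * partial d f (setl (c :: l) (gam t0) q)))).
    { apply filterdiff_differentiable_pt_lim.
      rewrite setl_cons.
      eapply (is_derive_filterdiff G (gam t0 c) t0
        (fun z t => partial c f (upd (setl l (gam t) q) c z))).
      - apply filter_forall; intros [z t]; apply is_derive_partial, dfun_ex_partial, Hf.
      - rewrite Hset.
        eapply is_derive_ext; [|apply (IH Hl' (upd q c (gam t0 c)))].
        intros t; unfold G; now rewrite Hset.
      - apply continuous_jets; [now apply dfun_partial|].
        intros d; unfold upd, setl.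
        destruct coord_eq_dec; [apply continuous_fst|].
        destruct in_dec; [|apply continuous_const].
        apply (continuous_comp snd (fun t => gam t d)); [apply continuous_snd|].
        apply (ex_derive_continuous (fun t => gam t d)); eexists; apply Hgam. }
    pose proof (derivable_pt_lim_comp_2d G (fun t => gam t c) (fun t => t) t0 _ _ _ _
      HG (proj1 (is_derive_Reals _ _ _) (Hgam c)) (derivable_pt_lim_id t0)) as H.
    apply is_derive_Reals in H.
    replace (lsum (c :: l) (fun d => xi d * partial d f (setl (c :: l) (gam t0) q)))
      with (partial c f (setl (c :: l) (gam t0) q) * xi c +
            lsum l (fun d => xi d * partial d f (setl (c :: l) (gam t0) q)) * 1);
      [exact H|].
    unfold lsum; simpl; ring.
Qed.

(** A function of order [n] does not notice that only the coordinates of level at most [n]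
    are moved along the curve. *)
Theorem chain_rule f n (gam : R -> jet C) t0 (xi : jet C) :
  dfun f -> order_le n f -> (forall c, is_derive (fun t => gam t c) t0 (xi c)) ->
  is_derive (fun t => f (gam t)) t0
    (lsum (coords n) (fun c => xi c * partial c f (gam t0))).
Proof.
  intros Hf Hn Hgam.
  assert (Hset : forall g t, order_le n g -> g (setl (coords n) (gam t) (gam t0)) = g (gam t)).
  { intros g t Hg; apply Hg; intros c Hc; unfold setl; destruct in_dec as [|H]; [easy|].
    exfalso; apply H, coords_complete, Hc. }
  pose proof (is_derive_setl f gam t0 xi Hf Hgam _ (coords_NoDup n) (gam t0)) as H.
  rewrite (lsum_ext _ _ (fun c => xi c * partial c f (gam t0))) in H.
  - eapply is_derive_ext; [|exact H]; intros t; simpl; apply (Hset f t Hn).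
  - intros c _; rewrite Hset; [easy | now apply order_le_partial].
Qed.

(** The derivative along a straight line rather than the sum over coordinates serves as the
    definition: naturality under linear maps of jets, such as renamings, is then immediate. *)
Definition lie (xi : C -> jfun C) f : jfun C :=
  fun p => Derive (fun tau => f (fun c => p c + tau * xi c p)) 0.

Lemma is_derive_line (a b t0 : R) : is_derive (fun t => a + t * b) t0 b.
Proof. auto_derive; [easy | ring]. Qed.

Lemma line_0 p q : (fun c => p c + 0 * q c) = p.
Proof. apply functional_extensionality; intros c; ring. Qed.

Lemma lie_is_derive xi f n p : dfun f -> order_le n f ->
  is_derive (fun tau => f (fun c => p c + tau * xi c p)) 0
    (lsum (coords n) (fun c => xi c p * partial c f p)).
Proof.
  intros Hf Hn.
  pose proof (chain_rule f n (fun tau c => p c + tau * xi c p) 0 (fun c => xi c p) Hf Hn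
    (fun c => is_derive_line _ _ _)) as H.
  cbv beta in H; rewrite (line_0 p (fun c => xi c p)) in H; exact H.
Qed.

Lemma lie_formula xi f n p : dfun f -> order_le n f ->
  lie xi f p = lsum (coords n) (fun c => xi c p * partial c f p).
Proof. intros Hf Hn; apply is_derive_unique; now apply lie_is_derive. Qed.

Lemma lie_ex xi f p : dfun f -> ex_derive (fun tau => f (fun c => p c + tau * xi c p)) 0.
Proof. intros Hf; eexists; apply lie_is_derive; [easy | now apply order_le_ord]. Qed.

Lemma lie_const xi k : lie xi (fconst k) = fconst 0.
Proof. apply functional_extensionality; intros p; apply (Derive_const k). Qed.

Lemma lie_coord xi c : lie xi (fcoord c) = xi c.
Proof.
  apply functional_extensionality; intros p; apply is_derive_unique, is_derive_line.
Qed.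

Lemma lie_add xi f g : dfun f -> dfun g -> lie xi (fadd f g) = fadd (lie xi f) (lie xi g).
Proof.
  intros Hf Hg; apply functional_extensionality; intros p; unfold lie, fadd.
  apply Derive_plus; now apply lie_ex.
Qed.

Lemma lie_mul xi f g : dfun f -> dfun g ->
  lie xi (fmul f g) = fadd (fmul (lie xi f) g) (fmul f (lie xi g)).
Proof.
  intros Hf Hg; apply functional_extensionality; intros p; unfold lie, fadd, fmul.
  rewrite Derive_mult by now apply lie_ex.
  now rewrite (line_0 p (fun c => xi c p)).
Qed.

Lemma lie_opp xi f : lie xi (fopp f) = fopp (lie xi f).
Proof. apply functional_extensionality; intros p; unfold lie, fopp; apply Derive_opp. Qed.

Lemma lie_fsum xi F n : (forall i, (i <= n)%nat -> dfun (F i)) ->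
  lie xi (fsum F n) = fsum (fun i => lie xi (F i)) n.
Proof.
  induction n; intros H; [reflexivity|].
  rewrite !fsum_S, lie_add, IHn; auto.
  apply dfun_fsum; auto.
Qed.

Definition flsum {A} (l : list A) (F : A -> jfun C) : jfun C := fun p => lsum l (fun a => F a p).

Lemma flsum_cons {A} (a : A) l F : flsum (a :: l) F = fadd (F a) (flsum l F).
Proof. reflexivity. Qed.

Lemma dfun_flsum {A} (l : list A) F : (forall a, In a l -> dfun (F a)) -> dfun (flsum l F).
Proof.
  induction l as [|a l IH]; intros H; [apply (dfun_const 0)|].
  rewrite flsum_cons; apply dfun_add; [apply H; now left | apply IH; intros; apply H; now right].
Qed.

Lemma lie_flsum {A} xi (l : list A) F : (forall a, In a l -> dfun (F a)) ->
  lie xi (flsum l F) = flsum l (fun a => lie xi (F a)).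
Proof.
  induction l as [|a l IH]; intros H; [apply (lie_const xi 0)|].
  rewrite !flsum_cons, lie_add, IH; auto.
  - intros; apply H; now right.
  - apply H; now left.
  - apply dfun_flsum; intros; apply H; now right.
Qed.

Lemma lie_formula_fun xi f n : dfun f -> order_le n f ->
  lie xi f = flsum (coords n) (fun c => fmul (xi c) (partial c f)).
Proof. intros; apply functional_extensionality; intros p; now apply lie_formula. Qed.

Lemma dfun_lie xi f : (forall c, dfun (xi c)) -> dfun f -> dfun (lie xi f).
Proof.
  intros Hxi Hf; rewrite (lie_formula_fun xi f (ord f)); auto using order_le_ord.
  apply dfun_flsum; intros; apply dfun_mul; auto using dfun_partial.
Qed.

Lemma lie_lie_formula xi eta f n p :
  (forall c, dfun (eta c)) -> dfun f -> order_le n f ->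
  lie xi (lie eta f) p =
    lsum (coords n) (fun c => lie xi (eta c) p * partial c f p) +
    lsum (coords n) (fun c => lsum (coords n) (fun d =>
      xi d p * eta c p * partial d (partial c f) p)).
Proof.
  intros Heta Hf Hn.
  rewrite (lie_formula_fun eta f n), lie_flsum by
    (auto; intros; apply dfun_mul; auto using dfun_partial).
  unfold flsum; rewrite <- lsum_plus; apply lsum_ext; intros c _.
  rewrite lie_mul by auto using dfun_partial; unfold fadd, fmul; f_equal.
  rewrite (lie_formula xi _ n) by auto using dfun_partial, order_le_partial.
  rewrite <- lsum_scal; apply lsum_ext; intros; ring.
Qed.

(** Second derivatives are symmetric, so only the derivatives of the components of the two
    fields enter the commutator. *)
Theorem lie_comm xi eta f :
  (forall c, dfun (xi c)) -> (forall c, dfun (eta c)) ->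
  (forall c, lie xi (eta c) = lie eta (xi c)) ->
  dfun f -> lie xi (lie eta f) = lie eta (lie xi f).
Proof.
  intros Hxi Heta Hcomm Hf; apply functional_extensionality; intros p.
  pose proof (order_le_ord f Hf) as Hn.
  rewrite !(lie_lie_formula _ _ f (ord f)) by auto; f_equal.
  - apply lsum_ext; intros; now rewrite Hcomm.
  - rewrite lsum_swap; apply lsum_ext; intros c _; apply lsum_ext; intros d _.
    rewrite (partial_comm c d f Hf); ring.
Qed.

(** Total derivatives truncate their sums at [ord f], which is meaningful for differential
    functions only; hence the restriction. *)
Definition derivation (D : jfun C -> jfun C) (xi : C -> jfun C) : Prop :=
  (forall c, dfun (xi c)) /\ forall f, dfun f -> D f = lie xi f.

Section Derivation.
Context (D : jfun C -> jfun C) (xi : C -> jfun C) (HD : derivation D xi).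

Lemma D_dfun f : dfun f -> dfun (D f).
Proof. intros Hf; rewrite (proj2 HD f Hf); apply dfun_lie; [apply HD | easy]. Qed.

Lemma D_add f g : dfun f -> dfun g -> D (fadd f g) = fadd (D f) (D g).
Proof. intros Hf Hg; rewrite !(proj2 HD) by auto using dfun_add; now apply lie_add. Qed.

Lemma D_mul f g : dfun f -> dfun g -> D (fmul f g) = fadd (fmul (D f) g) (fmul f (D g)).
Proof. intros Hf Hg; rewrite !(proj2 HD) by auto using dfun_mul; now apply lie_mul. Qed.

Lemma D_opp f : dfun f -> D (fopp f) = fopp (D f).
Proof. intros Hf; rewrite !(proj2 HD) by auto using dfun_opp; apply lie_opp. Qed.

Lemma D_const k : D (fconst k) = fconst 0.
Proof. rewrite (proj2 HD) by apply dfun_const; apply lie_const. Qed.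

Lemma D_fsum F n : (forall i, (i <= n)%nat -> dfun (F i)) ->
  D (fsum F n) = fsum (fun i => D (F i)) n.
Proof.
  intros H; rewrite (proj2 HD) by (now apply dfun_fsum).
  rewrite lie_fsum by easy; apply functional_extensionality; intros p.
  apply sum_eq; intros i Hi; now rewrite (proj2 HD) by auto.
Qed.

Lemma iter_dfun i f : dfun f -> dfun (Nat.iter i D f).
Proof. intros Hf; induction i; [easy|]; simpl; now apply D_dfun. Qed.

Lemma iter_add i f g : dfun f -> dfun g ->
  Nat.iter i D (fadd f g) = fadd (Nat.iter i D f) (Nat.iter i D g).
Proof.
  intros Hf Hg; induction i; [easy|]; simpl; rewrite IHi; apply D_add; now apply iter_dfun.
Qed.

Lemma iter_opp i f : dfun f -> Nat.iter i D (fopp f) = fopp (Nat.iter i D f).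
Proof. intros Hf; induction i; [easy|]; simpl; rewrite IHi; apply D_opp; now apply iter_dfun. Qed.

Lemma iter_zero i : Nat.iter i D (fconst 0) = fconst 0.
Proof. induction i; [easy|]; simpl; rewrite IHi; apply D_const. Qed.

End Derivation.

Lemma fopp_const0 : fopp (fconst (C := C) 0) = fconst 0.
Proof. apply functional_extensionality; intros p; unfold fopp, fconst; ring. Qed.

(** Thanks to this, the iterates of -D_x need no separate treatment. *)
Lemma derivation_opp D xi : derivation D xi ->
  derivation (fun f => fopp (D f)) (fun c => fopp (xi c)).
Proof.
  intros [Hxi HD]; split; [intros; now apply dfun_opp|].
  intros f Hf; rewrite (HD f Hf); apply functional_extensionality; intros p.
  unfold fopp at 1; rewrite !(lie_formula _ f (ord f)) by auto using order_le_ord.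
  replace (- lsum _ _) with (-1 * lsum (coords (ord f)) (fun c => xi c p * partial c f p)) by ring.
  rewrite <- lsum_scal; apply lsum_ext; intros; unfold fopp; ring.
Qed.

End Lie.

(** * The total derivatives as derivations *)

Definition coords1 (n : nat) : list coord1 := X :: map U (seq 0 (S n)).

Definition coords2 (n : nat) : list coord2 :=
  T2 :: X2 :: flat_map (fun a => map (W a) (seq 0 (S n))) (seq 0 (S n)).

#[export] Instance FinCoords1 : FinCoords coord1.
Proof.
  refine {| coords := coords1 |}.
  - intros n; constructor.
    + rewrite in_map_iff; intros [i [H _]]; discriminate H.
    + apply FinFun.Injective_map_NoDup; [intros i j H; congruence | apply seq_NoDup].
  - intros n [|i] H; [now left|]; right; apply in_map, in_seq; simpl in H; lia.
Defined.

#[export] Instance FinCoords2 : FinCoords coord2.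
Proof.
  refine {| coords := coords2 |}.
  - intros n; unfold coords2.
    assert (Hin : forall l c, In c (flat_map (fun a => map (W a) (seq 0 (S n))) l) ->
              exists a i, c = W a i /\ In a l).
    { intros l c H; apply in_flat_map in H as [a [Ha Hc]].
      apply in_map_iff in Hc as [i [<- _]]; eauto. }
    constructor; [|constructor].
    + intros [H|H]; [discriminate H|].
      apply Hin in H as [a [i [H _]]]; discriminate H.
    + intros H; apply Hin in H as [a [i [H _]]]; discriminate H.
    + assert (HN : forall l, NoDup l ->
                NoDup (flat_map (fun a => map (W a) (seq 0 (S n))) l));
        [|apply HN, seq_NoDup].
      intros l Hl; induction Hl as [|a l Ha Hl IH]; [constructor|].
      apply NoDup_app.
      * apply FinFun.Injective_map_NoDup; [intros i j H; congruence | apply seq_NoDup].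
      * exact IH.
      * intros c H1 H2.
        apply Hin in H2 as [b [i [-> Hb]]].
        apply in_map_iff in H1 as [j [H1 _]]; congruence.
  - intros n [| |a i] H; [now left | right; now left |]; right; right; simpl in H.
    apply in_flat_map; exists a; split; [apply in_seq; lia | apply in_map, in_seq; lia].
Defined.

Definition x_field (c : coord1) : jfun coord1 :=
  match c with X => fconst 1 | U i => fcoord (U (S i)) end.

Definition x_field2 (c : coord2) : jfun coord2 :=
  match c with T2 => fconst 0 | X2 => fconst 1 | W a i => fcoord (W a (S i)) end.

Definition t_field2 (c : coord2) : jfun coord2 :=
  match c with T2 => fconst 1 | X2 => fconst 0 | W a i => fcoord (W (S a) i) end.

Lemma lie_formula1 xi f n p : dfun f -> order_le n f ->
  lie xi f p = xi X p * partial X f p + sum_f_R0 (fun i => xi (U i) p * partial (U i) f p) n.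
Proof.
  intros Hf Hn; rewrite (lie_formula xi f n p Hf Hn), <- lsum_seq.
  now rewrite <- (lsum_map U _ (fun c => xi c p * partial c f p)).
Qed.

Lemma lie_formula2 xi f n p : dfun f -> order_le n f ->
  lie xi f p = xi T2 p * partial T2 f p + xi X2 p * partial X2 f p +
    sum_f_R0 (fun a => sum_f_R0 (fun i => xi (W a i) p * partial (W a i) f p) n) n.
Proof.
  intros Hf Hn; rewrite (lie_formula xi f n p Hf Hn).
  change (lsum (coords n) ?F) with (F T2 + (F X2 +
    lsum (flat_map (fun a => map (W a) (seq 0 (S n))) (seq 0 (S n))) F)).
  rewrite lsum_flat_map, <- lsum_seq, Rplus_assoc; do 2 f_equal.
  apply lsum_ext; intros a _; now rewrite lsum_map, lsum_seq.
Qed.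

Lemma TDx_derivation : derivation TDx x_field.
Proof.
  split; [intros [|i]; [apply dfun_const | apply dfun_coord]|].
  intros f Hf; apply functional_extensionality; intros p.
  rewrite (lie_formula1 _ f (ord f)) by (auto using order_le_ord).
  unfold TDx, x_field, fconst, fcoord; ring.
Qed.

Lemma TDx2_derivation : derivation TDx2 x_field2.
Proof.
  split; [intros [| |a i]; [apply dfun_const | apply dfun_const | apply dfun_coord]|].
  intros f Hf; apply functional_extensionality; intros p.
  rewrite (lie_formula2 _ f (ord f)) by (auto using order_le_ord).
  unfold TDx2, x_field2, fconst, fcoord; ring.
Qed.

Lemma TDt2_derivation : derivation TDt2 t_field2.
Proof.
  split; [intros [| |a i]; [apply dfun_const | apply dfun_const | apply dfun_coord]|].
  intros f Hf; apply functional_extensionality; intros p.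
  rewrite (lie_formula2 _ f (ord f)) by (auto using order_le_ord).
  unfold TDt2, t_field2, fconst, fcoord; ring.
Qed.

Lemma mTDx_derivation : derivation mTDx (fun c => fopp (x_field c)).
Proof. exact (derivation_opp _ _ TDx_derivation). Qed.

Lemma mTDx2_derivation : derivation mTDx2 (fun c => fopp (x_field2 c)).
Proof. exact (derivation_opp _ _ TDx2_derivation). Qed.

Lemma mTDt2_derivation : derivation mTDt2 (fun c => fopp (t_field2 c)).
Proof. exact (derivation_opp _ _ TDt2_derivation). Qed.

(** * Renaming coordinates *)

Section Reindex.
Context {C C' : Type} {HC : Coords C} {HC' : Coords C'} (phi : C -> C').

Definition reindex (f : jfun C) : jfun C' := fun p => f (fun c => p (phi c)).

(** Renaming coordinates is linear, so it carries the line along [eta] to the line along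
    [xi]. *)
Lemma lie_reindex xi eta (f : jfun C) :
  (forall c, eta (phi c) = reindex (xi c)) -> lie eta (reindex f) = reindex (lie xi f).
Proof.
  intros H; apply functional_extensionality; intros p; unfold lie, reindex.
  apply Derive_ext; intros tau; f_equal; apply functional_extensionality; intros c.
  now rewrite H.
Qed.

Context (phi_inj : forall c d, phi c = phi d -> c = d).

Lemma upd_reindex (p : jet C') c s :
  (fun d => upd p (phi c) s (phi d)) = upd (fun d => p (phi d)) c s.
Proof.
  apply functional_extensionality; intros d; unfold upd.
  destruct (coord_eq_dec (phi d) (phi c)), (coord_eq_dec d c); try congruence.
  exfalso; auto.
Qed.

Lemma partial_reindex c f : partial (phi c) (reindex f) = reindex (partial c f).
Proof.
  apply functional_extensionality; intros p; unfold partial, reindex.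
  apply Derive_ext; intros s; now rewrite upd_reindex.
Qed.

Lemma reindex_upd_out d f p s : (forall c, phi c <> d) -> reindex f (upd p d s) = reindex f p.
Proof.
  intros H; unfold reindex; f_equal; apply functional_extensionality; intros c.
  apply upd_other; auto.
Qed.

Lemma partial_reindex_out d f : (forall c, phi c <> d) -> partial d (reindex f) = fconst 0.
Proof.
  intros H; apply functional_extensionality; intros p; unfold partial, fconst.
  rewrite (Derive_ext _ (fun _ => reindex f p)); [apply Derive_const|].
  intros s; now apply reindex_upd_out.
Qed.

Lemma Ck_reindex n f : Ck n f -> Ck n (reindex f).
Proof.
  assert (Hcont : forall f, (forall p, @continuous (fct_UniformSpace C R_UniformSpace)
                                  R_UniformSpace f p) ->
            forall p, @continuous (fct_UniformSpace C' R_UniformSpace) R_UniformSpace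
                        (reindex f) p).
  { intros g Hg p; apply jcont_eps; intros e.
    destruct (proj1 (jcont_eps g _) (Hg (fun c => p (phi c))) e) as [del Hdel].
    exists del; intros q Hq; apply Hdel; intros c; apply Hq. }
  revert f; induction n; intros f [Hf Hf']; (split; [exact (Hcont f Hf)|]); [exact I|].
  intros d; destruct (excluded_middle_informative (exists c, phi c = d)) as [[c <-]|Hd].
  - destruct (Hf' c) as [H1 H2]; rewrite partial_reindex; split; [|exact (IHn _ H2)].
    intros p; eapply ex_derive_ext; [|apply (H1 (fun c => p (phi c)))].
    intros s; unfold reindex; simpl; now rewrite upd_reindex.
  - assert (Hd' : forall c, phi c <> d) by eauto.
    rewrite partial_reindex_out by easy; split; [|apply Ck_const].
    intros p; exists 0; apply (is_derive_ext (fun _ => reindex f p)).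
    + intros s; now rewrite reindex_upd_out.
    + apply (is_derive_const (reindex f p)).
Qed.

Context (k : nat) (phi_level : forall c, (level (phi c) <= level c + k)%nat).

Lemma order_le_reindex n f : order_le n f -> order_le (n + k) (reindex f).
Proof.
  intros H p q Hpq; apply H; intros c Hc; apply Hpq; specialize (phi_level c); lia.
Qed.

Lemma dfun_reindex f : dfun f -> dfun (reindex f).
Proof.
  intros [Hf [n Hn]]; split; [|exists (n + k)%nat; now apply order_le_reindex].
  apply smooth_Ck; intros j; now apply Ck_reindex, smooth_Ck.
Qed.

End Reindex.

Definition ux_index (c : coord1) : coord1 := match c with X => X | U i => U (S i) end.
Definition lift_index (c : coord1) : coord2 := match c with X => X2 | U i => W 0 i end.

Lemma subst_ux_reindex : subst_ux = reindex ux_index.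
Proof.
  apply functional_extensionality; intros f; apply functional_extensionality; intros p.
  unfold subst_ux, reindex; f_equal; apply functional_extensionality; now intros [|i].
Qed.

Lemma lift_reindex : lift = reindex lift_index.
Proof.
  apply functional_extensionality; intros f; apply functional_extensionality; intros p.
  unfold lift, reindex; f_equal; apply functional_extensionality; now intros [|i].
Qed.

Lemma ux_index_inj c d : ux_index c = ux_index d -> c = d.
Proof. destruct c, d; simpl; congruence. Qed.

Lemma lift_index_inj c d : lift_index c = lift_index d -> c = d.
Proof. destruct c, d; simpl; congruence. Qed.

Lemma order_le_subst n f : order_le n f -> order_le (S n) (subst_ux f).
Proof.
  intros H; rewrite subst_ux_reindex, <- PeanoNat.Nat.add_1_r; apply order_le_reindex; [|easy].
  intros [|i]; simpl; lia.
Qed.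

Lemma dfun_subst f : dfun f -> dfun (subst_ux f).
Proof.
  rewrite subst_ux_reindex; apply dfun_reindex with (k := 1%nat); [apply ux_index_inj|].
  intros [|i]; simpl; lia.
Qed.

Lemma order_le_lift n f : order_le n f -> order_le n (lift f).
Proof.
  intros H; rewrite lift_reindex, <- (PeanoNat.Nat.add_0_r n); apply order_le_reindex; [|easy].
  intros [|i]; simpl; lia.
Qed.

Lemma dfun_lift f : dfun f -> dfun (lift f).
Proof.
  rewrite lift_reindex; apply dfun_reindex with (k := 0%nat); [apply lift_index_inj|].
  intros [|i]; simpl; lia.
Qed.

Lemma TDx_subst f : dfun f -> TDx (subst_ux f) = subst_ux (TDx f).
Proof.
  intros Hf; rewrite !(proj2 TDx_derivation) by auto using dfun_subst.
  rewrite subst_ux_reindex; apply lie_reindex; now intros [|i].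
Qed.

Lemma TDx2_lift f : dfun f -> TDx2 (lift f) = lift (TDx f).
Proof.
  intros Hf; rewrite (proj2 TDx2_derivation), (proj2 TDx_derivation) by auto using dfun_lift.
  rewrite lift_reindex; apply lie_reindex; now intros [|i].
Qed.

Lemma iter_intertwine {C C'} {HC : Coords C} {HC' : Coords C'} (h : jfun C -> jfun C') D D' :
  (forall f, dfun f -> dfun (D f)) -> (forall f, dfun f -> D' (h f) = h (D f)) ->
  forall i f, dfun f -> Nat.iter i D' (h f) = h (Nat.iter i D f).
Proof.
  intros HD Hh i f Hf; induction i; [easy|]; simpl; rewrite IHi; apply Hh.
  clear IHi; induction i; [easy|]; now apply HD.
Qed.

Lemma mTDx_subst f : dfun f -> mTDx (subst_ux f) = subst_ux (mTDx f).
Proof. intros Hf; unfold mTDx; now rewrite TDx_subst. Qed.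

Lemma mTDx2_lift f : dfun f -> mTDx2 (lift f) = lift (mTDx f).
Proof. intros Hf; unfold mTDx2, mTDx; now rewrite TDx2_lift. Qed.

(** * The Euler operator under the substitution v = u_x *)

Lemma sum_bound F m n : (forall i, (m < i)%nat -> F i = 0) -> (forall i, (n < i)%nat -> F i = 0) ->
  sum_f_R0 F m = sum_f_R0 F n.
Proof.
  assert (Hle : forall m n, (m <= n)%nat -> (forall i, (m < i)%nat -> F i = 0) ->
            sum_f_R0 F n = sum_f_R0 F m).
  { clear m n; intros m n Hmn H; induction Hmn; [easy|]; simpl; rewrite IHHmn, H; [ring | lia]. }
  intros Hm Hn; destruct (PeanoNat.Nat.le_ge_cases m n).
  - symmetry; auto.
  - auto.
Qed.

Lemma partial_U_above n i f : order_le n f -> (n < i)%nat -> partial (U i) f = fconst 0.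
Proof. intros H Hi; now apply (partial_above n). Qed.

Lemma Euler_formula H n : dfun H -> order_le n H ->
  Euler H = fsum (fun i => Nat.iter i mTDx (partial (U i) H)) n.
Proof.
  intros HH Hn; apply functional_extensionality; intros p; apply sum_bound; intros i Hi.
  - rewrite (partial_U_above (ord H)) by auto using order_le_ord.
    now rewrite (iter_zero _ _ mTDx_derivation).
  - rewrite (partial_U_above n) by auto.
    now rewrite (iter_zero _ _ mTDx_derivation).
Qed.

Lemma dfun_Euler H : dfun H -> dfun (Euler H).
Proof.
  intros HH; rewrite (Euler_formula H (ord H)) by auto using order_le_ord.
  apply dfun_fsum; intros; apply (iter_dfun _ _ mTDx_derivation), dfun_partial, HH.
Qed.

Lemma subst_fsum F n : subst_ux (fsum F n) = fsum (fun i => subst_ux (F i)) n.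
Proof. reflexivity. Qed.

(** The derivatives of [H(x,u_x,u_xx,...)] are those of [H], shifted by one order; the extra
    total derivative that each summand acquires factors out. *)
Lemma Euler_subst H : dfun H -> Euler (subst_ux H) = fopp (TDx (subst_ux (Euler H))).
Proof.
  intros HH; pose proof (order_le_ord H HH) as Hn; set (n := ord H) in *.
  rewrite (Euler_formula (subst_ux H) (S n)) by auto using dfun_subst, order_le_subst.
  rewrite (Euler_formula H n), subst_fsum by easy.
  change (fopp (TDx ?f)) with (mTDx f).
  assert (Hd : forall i, dfun (subst_ux (Nat.iter i mTDx (partial (U i) H)))).
  { intros i; apply dfun_subst, (iter_dfun _ _ mTDx_derivation), dfun_partial, HH. }
  rewrite (D_fsum _ _ mTDx_derivation) by auto.
  apply functional_extensionality; intros p; unfold fsum.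
  rewrite decomp_sum by lia; simpl pred.
  replace (Nat.iter 0 mTDx (partial (U 0) (subst_ux H)) p) with 0.
  - rewrite Rplus_0_l; apply sum_eq; intros i _.
    rewrite subst_ux_reindex, (partial_reindex ux_index ux_index_inj (U i)).
    rewrite <- subst_ux_reindex.
    simpl; rewrite (iter_intertwine subst_ux mTDx mTDx); auto using dfun_partial.
    + apply (D_dfun _ _ mTDx_derivation).
    + apply mTDx_subst.
  - simpl; rewrite subst_ux_reindex, partial_reindex_out; [easy|]; now intros [|i].
Qed.

Lemma op_apply_subst A f p : dfun f ->
  op_apply TDx (op_subst_ux A) (subst_ux f) p = subst_ux (op_apply TDx A f) p.
Proof.
  intros Hf; unfold op_apply; simpl; unfold subst_ux at 3.
  apply sum_eq; intros i _.
  rewrite (iter_intertwine subst_ux TDx TDx); auto using TDx_subst.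
  apply (D_dfun _ _ TDx_derivation).
Qed.

Lemma potential_gradient H1 H2 D0 : dfun H1 -> dfun H2 ->
  (forall p, op_apply TDx D0 (Euler H1) p = TDx (Euler H2) p) ->
  forall p, op_apply TDx (op_subst_ux D0) (subst_ux (Euler H1)) p = - Euler (subst_ux H2) p.
Proof.
  intros HH1 HH2 H p.
  rewrite op_apply_subst, Euler_subst, TDx_subst by auto using dfun_Euler.
  unfold fopp; rewrite Ropp_involutive; apply H.
Qed.

(** * Adjoints in normal form *)

(** Coefficient of [D^i] in the operator [(-D)^j] composed with multiplication by [q]. *)
Fixpoint adj_coef {C} (D : jfun C -> jfun C) (j : nat) (q : jfun C) (i : nat) : jfun C :=
  match j with
  | 0%nat => match i with 0%nat => q | S _ => fconst 0 end
  | S j' => fopp (fadd (D (adj_coef D j' q i))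
                       (match i with 0%nat => fconst 0 | S i' => adj_coef D j' q i' end))
  end.

Definition op_adj_coef {C} (D : jfun C -> jfun C) (A : dop C) (i : nat) : jfun C :=
  fsum (fun j => adj_coef D j (op_coef A j) i) (op_order A).

Section Adjoint.
Context {C : Type} {HC : Coords C} {FC : FinCoords C}.
Context (D : jfun C -> jfun C) (xi : C -> jfun C) (HD : derivation D xi).

Lemma dfun_adj_coef j q i : dfun q -> dfun (adj_coef D j q i).
Proof.
  intros Hq; revert i; induction j; intros i; simpl.
  - destruct i; [easy | apply dfun_const].
  - apply dfun_opp, dfun_add; [now apply (D_dfun D xi HD)|].
    destruct i; [apply dfun_const | easy].
Qed.

Lemma adj_coef_above j q i : (j < i)%nat -> adj_coef D j q i = fconst 0.
Proof.
  revert i; induction j; intros i Hi; destruct i as [|i]; try lia; [easy|]; simpl.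
  rewrite !IHj by lia; rewrite (D_const D xi HD).
  apply functional_extensionality; intros p; unfold fopp, fadd, fconst; ring.
Qed.

(** The bound [N] is free so that operators of different orders can be compared on a common
    range of indices. *)
Lemma iter_opp_mul N j q w p : dfun q -> dfun w -> (j <= N)%nat ->
  Nat.iter j (fun g => fopp (D g)) (fmul q w) p =
    sum_f_R0 (fun i => adj_coef D j q i p * Nat.iter i D w p) N.
Proof.
  intros Hq Hw; revert p; induction j; intros p Hj.
  - rewrite (sum_bound _ N 0).
    + reflexivity.
    + intros i Hi; destruct i; [lia|]; simpl; unfold fconst; ring.
    + intros i Hi; destruct i; [lia|]; simpl; unfold fconst; ring.
  - assert (E : Nat.iter j (fun g => fopp (D g)) (fmul q w)
                = fsum (fun i => fmul (adj_coef D j q i) (Nat.iter i D w)) N).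
    { apply functional_extensionality; intros p'; apply IHj; lia. }
    simpl; rewrite E.
    assert (Hc : forall i, dfun (adj_coef D j q i)) by (intros; now apply dfun_adj_coef).
    assert (Hi : forall i, dfun (Nat.iter i D w)) by (intros; now apply (iter_dfun D xi HD)).
    rewrite (D_fsum D xi HD) by auto using dfun_mul.
    unfold fopp at 1, fsum at 1.
    rewrite (sum_eq _ (fun i => D (adj_coef D j q i) p * Nat.iter i D w p
                              + adj_coef D j q i p * Nat.iter (S i) D w p)) by
      (intros i _; rewrite (D_mul D xi HD) by auto; reflexivity).
    rewrite sum_plus.
    (* The second half is shifted by one; its last term vanishes because j < N. *)
    assert (Hshift : sum_f_R0 (fun i => adj_coef D j q i p * Nat.iter (S i) D w p) N =
              sum_f_R0 (fun i => match i with 0%nat => fconst 0 | S i' => adj_coef D j q i' end p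
                                 * Nat.iter i D w p) N).
    { destruct N as [|N]; [lia|].
      rewrite (decomp_sum (fun i => match i with 0%nat => _ | S _ => _ end p * _)) by lia.
      simpl sum_f_R0 at 1; rewrite (adj_coef_above j q (S N)) by lia.
      simpl pred; unfold fconst; simpl; ring. }
    rewrite Hshift, <- sum_plus.
    replace (- sum_f_R0 _ N) with (-1 * sum_f_R0 (fun i =>
      D (adj_coef D j q i) p * Nat.iter i D w p +
      match i with 0%nat => fconst 0 | S i' => adj_coef D j q i' end p * Nat.iter i D w p) N)
      by ring.
    rewrite scal_sum; apply sum_eq; intros i _; unfold fopp, fadd; ring.
Qed.

Lemma op_adj_coef_dfun A i : dop_wf A -> dfun (op_adj_coef D A i).
Proof. intros HA; apply dfun_fsum; intros; now apply dfun_adj_coef, HA. Qed.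

Lemma op_adjoint_normal N A w p : dop_wf A -> dfun w -> (op_order A <= N)%nat ->
  op_adjoint D A w p = sum_f_R0 (fun i => op_adj_coef D A i p * Nat.iter i D w p) N.
Proof.
  intros HA Hw HN; unfold op_adjoint, op_adj_coef, fsum.
  rewrite (sum_eq _ (fun j => sum_f_R0 (fun i =>
    adj_coef D j (op_coef A j) i p * Nat.iter i D w p) N)).
  - rewrite <- !lsum_seq, (lsum_ext _ _ (fun j => lsum (seq 0 (S N)) (fun i =>
      adj_coef D j (op_coef A j) i p * Nat.iter i D w p))) by (intros; now rewrite lsum_seq).
    rewrite lsum_swap; apply lsum_ext; intros i _.
    rewrite <- lsum_seq, Rmult_comm, <- lsum_scal; apply lsum_ext; intros; ring.
  - intros j Hj; apply (iter_opp_mul N j _ w p); [now apply HA | easy | lia].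
Qed.

End Adjoint.

(** Adjoint coefficients are built from D and additive operations alone. It is used for the
    pullback to two independent variables and for radial integration. *)
Lemma adj_coef_intertwine {C C'} {HC : Coords C} {HC' : Coords C'} {FC : FinCoords C}
    (h : jfun C -> jfun C') D xi D' :
  derivation D xi -> (forall f, dfun f -> D' (h f) = h (D f)) ->
  h (fconst 0) = fconst 0 -> (forall f, dfun f -> h (fopp f) = fopp (h f)) ->
  (forall f g, dfun f -> dfun g -> h (fadd f g) = fadd (h f) (h g)) ->
  forall j q i, dfun q -> adj_coef D' j (h q) i = h (adj_coef D j q i).
Proof.
  intros HD Hh H0 Hopp Hadd j q i Hq; revert i; induction j; intros i; simpl.
  - now destruct i.
  - assert (Hc : forall i, dfun (adj_coef D j q i)) by (intros; now apply (dfun_adj_coef D xi HD)).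
    assert (HDc : dfun (D (adj_coef D j q i))) by (now apply (D_dfun D xi HD)).
    rewrite Hopp, Hadd, IHj, Hh; auto.
    + destruct i; [now rewrite H0 | now rewrite IHj].
    + destruct i; [apply dfun_const | easy].
    + apply dfun_add; [easy|]; destruct i; [apply dfun_const | easy].
Qed.

(** * The radial homotopy *)

Definition scal_jet (l : R) (p : jet coord1) : jet coord1 :=
  fun c => match c with X => p X | U i => l * p (U i) end.

(** The weight [k] is a parameter because each derivative in a fibre coordinate produces a
    factor [l]. *)
Definition radial (k : nat) (F : jfun coord1) : jfun coord1 :=
  fun p => RInt (fun l => l ^ k * F (scal_jet l p)) 0 1.

Definition scaling_field (c : coord1) : jfun coord1 :=
  match c with X => fconst 0 | U i => fcoord (U i) end.

Notation jetspace := (fct_UniformSpace coord1 R_UniformSpace).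

Lemma continuous_pow (k : nat) (l : R) : continuous (fun t : R => t ^ k) l.
Proof. apply (ex_derive_continuous (fun t : R => t ^ k)); auto_derive; easy. Qed.

Lemma continuous_lsum {A : Type} (B : UniformSpace) (l : list A) (F : A -> B -> R) b :
  (forall a, continuous (F a) b) -> continuous (fun x => lsum l (fun a => F a x)) b.
Proof.
  intros H; induction l as [|a l IH]; [apply continuous_const|].
  apply (continuous_plus (V := R_NormedModule) (F a)); [apply H | exact IH].
Qed.

Lemma continuous_scal F (p : jet coord1) (l : R) : dfun F ->
  continuous (fun t => F (scal_jet t p)) l.
Proof.
  intros HF; apply (continuous_jets R_UniformSpace F (fun t => scal_jet t p)); [easy|].
  intros [|i]; simpl; [apply continuous_const|].
  apply (ex_derive_continuous (fun x : R => x * p (U i))); auto_derive; easy.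
Qed.

Lemma continuous_integrand k F p (l : R) : dfun F ->
  continuous (fun t => t ^ k * F (scal_jet t p)) l.
Proof.
  intros HF; apply (continuous_mult (K := R_AbsRing) (fun t : R => t ^ k)).
  - apply continuous_pow.
  - now apply continuous_scal.
Qed.

Lemma ex_RInt_radial k F p : dfun F -> ex_RInt (fun t => t ^ k * F (scal_jet t p)) 0 1.
Proof.
  intros HF; apply (ex_RInt_continuous (V := R_CompleteNormedModule)); intros.
  now apply continuous_integrand.
Qed.

Lemma radial_add k F G : dfun F -> dfun G -> radial k (fadd F G) = fadd (radial k F) (radial k G).
Proof.
  intros HF HG; apply functional_extensionality; intros p; unfold radial, fadd.
  rewrite <- (RInt_plus (V := R_CompleteNormedModule)
    (fun t => t ^ k * F (scal_jet t p))) by now apply ex_RInt_radial.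
  apply RInt_ext; intros; simpl; unfold plus; simpl; ring.
Qed.

Lemma radial_opp k F : dfun F -> radial k (fopp F) = fopp (radial k F).
Proof.
  intros HF; apply functional_extensionality; intros p; unfold radial, fopp.
  rewrite <- (RInt_opp (V := R_CompleteNormedModule)
    (fun t => t ^ k * F (scal_jet t p))) by now apply ex_RInt_radial.
  apply RInt_ext; intros; simpl; unfold opp; simpl; ring.
Qed.

Lemma radial_zero k : radial k (fconst 0) = fconst 0.
Proof.
  apply functional_extensionality; intros p; unfold radial, fconst.
  rewrite (RInt_ext _ (fun _ => 0)) by (intros; simpl; ring).
  rewrite RInt_const; unfold scal; simpl; unfold mult; simpl; ring.
Qed.

Lemma order_le_radial k F n : order_le n F -> order_le n (radial k F).
Proof.
  intros H p q Hpq; unfold radial; apply RInt_ext; intros l _; f_equal.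
  apply H; intros [|i] Hc; simpl; now rewrite Hpq.
Qed.

Lemma is_derive_scal_jet (gam : R -> jet coord1) (xi : jet coord1) t l :
  (forall c, is_derive (fun t => gam t c) t (xi c)) ->
  forall c, is_derive (fun t => scal_jet l (gam t) c) t (scal_jet l xi c).
Proof.
  intros H [|i]; simpl; [apply H|].
  apply (is_derive_scal (fun t => gam t (U i))), H.
Qed.

(** Differentiation under the integral sign, for jets that move with constant velocity: this
    covers both partial derivatives and the lines that define [lie]. *)
Lemma radial_is_derive k F n (gam : R -> jet coord1) (xi : jet coord1) t :
  dfun F -> order_le n F -> (forall c t, is_derive (fun t => gam t c) t (xi c)) ->
  is_derive (fun t => radial k F (gam t)) t
    (RInt (fun l => l ^ k * lsum (coords n)
       (fun c => scal_jet l xi c * partial c F (scal_jet l (gam t)))) 0 1).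
Proof.
  intros HF Hn Hgam.
  pose (dF := fun u l => l ^ k * lsum (coords n)
       (fun c => scal_jet l xi c * partial c F (scal_jet l (gam u)))).
  assert (HD : forall u l, is_derive (fun u => l ^ k * F (scal_jet l (gam u))) u (dF u l)).
  { intros u l; apply (is_derive_scal (fun u => F (scal_jet l (gam u)))).
    apply (chain_rule F n (fun u => scal_jet l (gam u)) u (scal_jet l xi) HF Hn).
    intros c; apply is_derive_scal_jet; intros; apply Hgam. }
  change (fun t => radial k F (gam t))
    with (fun u => RInt (fun l => l ^ k * F (scal_jet l (gam u))) 0 1).
  rewrite (RInt_ext _ (fun l => Derive (fun u => l ^ k * F (scal_jet l (gam u))) t))
    by (intros l _; symmetry; apply is_derive_unique, HD).
  apply is_derive_RInt_param.
  - apply filter_forall; intros u l _; eexists; apply HD.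
  - intros l _; apply continuity_2d_pt_ext with (f := dF).
    + intros u v; symmetry; apply is_derive_unique, HD.
    + apply continuity_2d_pt_filterlim.
      assert (Hfst : forall c, continuous (fun z : R * R => gam (fst z) c) (t, l)).
      { intros c; apply (continuous_comp fst (fun u => gam u c)); [apply continuous_fst|].
        apply (ex_derive_continuous (fun t => gam t c)); eexists; apply Hgam. }
      assert (Hsnd : continuous (fun z : R * R => snd z) (t, l)) by apply continuous_snd.
      unfold dF; change (continuous (fun z : R * R => mult (K := R_AbsRing) (snd z ^ k)
        (lsum (coords n) (fun c =>
          scal_jet (snd z) xi c * partial c F (scal_jet (snd z) (gam (fst z)))))) (t, l)).
      apply (continuous_mult (K := R_AbsRing) (fun z : R * R => snd z ^ k)
        (fun z : R * R => lsum (coords n) (fun c =>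
          scal_jet (snd z) xi c * partial c F (scal_jet (snd z) (gam (fst z)))))).
      * apply (continuous_comp snd (fun u : R => u ^ k)); [apply Hsnd | apply continuous_pow].
      * apply (continuous_lsum _ (coords n) (fun c (z : R * R) =>
          scal_jet (snd z) xi c * partial c F (scal_jet (snd z) (gam (fst z))))).
        intros c; apply (continuous_mult (K := R_AbsRing)
          (fun z : R * R => scal_jet (snd z) xi c)).
        -- destruct c as [|i]; simpl; [apply continuous_const|].
           apply (continuous_mult (K := R_AbsRing) (fun z : R * R => snd z));
             [apply Hsnd | apply continuous_const].
        -- apply (continuous_jets _ (partial c F)
             (fun z : R * R => scal_jet (snd z) (gam (fst z)))); [now apply dfun_partial|].
           intros [|i]; simpl; [apply Hfst|].
           apply (continuous_mult (K := R_AbsRing) (fun z : R * R => snd z)); [apply Hsnd|].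
           apply Hfst.
  - apply filter_forall; intros u; now apply ex_RInt_radial.
Qed.

Lemma lsum_pick {A} (eq_dec : forall a b : A, {a = b} + {a <> b}) (l : list A) a F :
  NoDup l -> In a l -> lsum l (fun b => (if eq_dec b a then 1 else 0) * F b) = F a.
Proof.
  intros Hl; induction Hl as [|b l Hb Hl IH]; [easy|].
  intros Ha; change (lsum (b :: l) ?G) with (G b + lsum l G); cbv beta.
  destruct (eq_dec b a) as [<-|Hne].
  - rewrite lsum_zero; [ring|]; intros c Hc; destruct eq_dec; [congruence | ring].
  - destruct Ha as [Ha|Ha]; [easy|]; rewrite IH by easy; ring.
Qed.

Lemma radial_partial_aux k F c p s : dfun F ->
  is_derive (fun t => radial k F (upd p c t)) s
    (match c with X => radial k (partial X F)
     | U i => radial (S k) (partial (U i) F) end (upd p c s)).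
Proof.
  intros HF.
  pose (n := Nat.max (ord F) (level c)).
  assert (Hn : order_le n F) by (apply (order_le_mono (ord F)); [lia | now apply order_le_ord]).
  pose proof (radial_is_derive k F n (fun t => upd p c t)
    (fun d => if coord_eq_dec d c then 1 else 0) s HF Hn
    (fun d t => is_derive_upd_coord p c d t)) as H.
  replace (match c with X => radial k (partial X F)
           | U i => radial (S k) (partial (U i) F) end (upd p c s)) with
    (RInt (fun l => l ^ k * lsum (coords n) (fun d =>
      scal_jet l (fun d => if coord_eq_dec d c then 1 else 0) d *
      partial d F (scal_jet l (upd p c s)))) 0 1); [exact H|].
  assert (E : forall l, lsum (coords n) (fun d =>
      scal_jet l (fun d => if coord_eq_dec d c then 1 else 0) d *
      partial d F (scal_jet l (upd p c s)))
      = match c with X => 1 | U _ => l end * partial c F (scal_jet l (upd p c s))).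
  { intros l.
    rewrite <- (lsum_pick coord_eq_dec (coords n) c (fun d =>
      match d with X => 1 | U _ => l end * partial d F (scal_jet l (upd p c s)))).
    - apply lsum_ext; intros d _; destruct d; unfold scal_jet at 1; ring.
    - apply coords_NoDup.
    - apply coords_complete; lia. }
  destruct c as [|i]; unfold radial; apply RInt_ext; intros l _; rewrite E; simpl; ring.
Qed.

Lemma ex_partial_radial k F c : dfun F -> ex_partial c (radial k F).
Proof. intros HF p; eexists; now apply radial_partial_aux. Qed.

Lemma partial_radial k F c : dfun F ->
  partial c (radial k F) = match c with X => radial k (partial X F)
                           | U i => radial (S k) (partial (U i) F) end.
Proof.
  intros HF; apply functional_extensionality; intros p; apply partial_unique.
  pose proof (radial_partial_aux k F c p (p c) HF) as H; now rewrite upd_self in H.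
Qed.

(** Finitely many of the neighbourhoods given by continuity cover the compact interval of
    parameters, and the smallest of their radii works for all of it. *)
Lemma tube (A : UniformSpace) (G : A * R -> R) (p : A) (e : R) : 0 < e ->
  (forall t, 0 <= t <= 1 -> continuous G (p, t)) ->
  exists del : posreal, forall q, ball p del q ->
    forall l, 0 <= l <= 1 -> Rabs (G (q, l) - G (p, l)) < e.
Proof.
  intros He HG.
  assert (He2 : 0 < e / 2) by lra.
  assert (Hloc : forall t, exists del : posreal, 0 <= t <= 1 -> forall q l, ball p del q ->
            Rabs (l - t) < del -> Rabs (G (q, l) - G (p, t)) < e / 2).
  { intros t.
    destruct (Rle_dec 0 t) as [H0|H0]; [|exists (mkposreal 1 Rlt_0_1); lra].
    destruct (Rle_dec t 1) as [H1|H1]; [|exists (mkposreal 1 Rlt_0_1); lra].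
    destruct (HG t (conj H0 H1) (ball (G (p, t)) (mkposreal _ He2)) (locally_ball _ _))
      as [del Hdel].
    exists del; intros _ q l Hq Hl; apply (Hdel (q, l)); split; [exact Hq | exact Hl]. }
  pose (d := fun t => proj1_sig (constructive_indefinite_description _ (Hloc t))).
  assert (Hd : forall t, 0 <= t <= 1 -> forall q l, ball p (d t) q ->
            Rabs (l - t) < d t -> Rabs (G (q, l) - G (p, t)) < e / 2).
  { intros t; unfold d; apply (proj2_sig (constructive_indefinite_description _ (Hloc t))). }
  destruct (compactness_value_1d 0 1 d) as [del Hdel].
  exists del; intros q Hq l Hl.
  destruct (Rlt_dec (Rabs (G (q, l) - G (p, l))) e) as [|Hn]; [easy|].
  exfalso; apply (Hdel l Hl); intros [t [Ht [Hlt Hdt]]]; apply Hn.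
  pose proof (Hd t Ht q l (ball_le p del (d t) Hdt q Hq) Hlt) as B1.
  pose proof (Hd t Ht p l (ball_center p (d t)) Hlt) as B2.
  replace (G (q, l) - G (p, l)) with ((G (q, l) - G (p, t)) - (G (p, l) - G (p, t))) by ring.
  eapply Rle_lt_trans; [apply Rabs_triang|]; rewrite Rabs_Ropp; lra.
Qed.

Lemma radial_continuous k F (p : jetspace) : dfun F ->
  @continuous jetspace R_UniformSpace (radial k F) p.
Proof.
  intros HF; apply jcont_eps; intros e.
  assert (He : 0 < e / 2) by (pose proof (cond_pos e); lra).
  destruct (tube jetspace (fun z => snd z ^ k * F (scal_jet (snd z) (fst z))) p (e / 2) He)
    as [del Hdel].
  { intros t _.
    assert (Hc : forall c, continuous (fun z : jetspace * R => fst z c) (p, t)).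
    { intros c; apply (continuous_comp fst (fun q : jetspace => q c)); [apply continuous_fst|].
      apply jcont_eps; intros e'; exists e'; intros q Hq; apply Hq. }
    assert (Hs : continuous (fun z : jetspace * R => snd z) (p, t)) by apply continuous_snd.
    apply (continuous_mult (K := R_AbsRing) (fun z : jetspace * R => snd z ^ k)).
    - apply (continuous_comp snd (fun u : R => u ^ k)); [apply Hs | apply continuous_pow].
    - apply (continuous_jets _ F (fun z : jetspace * R => scal_jet (snd z) (fst z))); [easy|].
      intros [|i]; simpl; [apply Hc|].
      apply (continuous_mult (K := R_AbsRing) (fun z : jetspace * R => snd z)); [apply Hs|].
      apply Hc. }
  exists del; intros q Hq; unfold radial.
  pose proof (RInt_minus (V := R_CompleteNormedModule) _ _ 0 1
    (ex_RInt_radial k F q HF) (ex_RInt_radial k F p HF)) as HR.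
  change (RInt (fun l => l ^ k * F (scal_jet l q)) 0 1 -
          RInt (fun l => l ^ k * F (scal_jet l p)) 0 1)
    with (minus (RInt (fun l => l ^ k * F (scal_jet l q)) 0 1)
                (RInt (fun l => l ^ k * F (scal_jet l p)) 0 1)).
  rewrite <- HR.
  apply Rle_lt_trans with ((1 - 0) * (e / 2)); [|pose proof (cond_pos e); lra].
  eapply (norm_RInt_le_const (V := R_NormedModule)); [lra| |].
  - intros l Hl; apply Rlt_le.
    apply (Hdel q Hq l Hl).
  - apply (RInt_correct (V := R_CompleteNormedModule)).
    apply (ex_RInt_minus (V := R_CompleteNormedModule)); now apply ex_RInt_radial.
Qed.

Lemma Ck_radial n k F : dfun F -> Ck n (radial k F).
Proof.
  revert k F; induction n; intros k F HF;
    (split; [intros p; now apply radial_continuous|]); [exact I|].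
  intros c; split; [now apply ex_partial_radial|].
  rewrite partial_radial by easy; destruct c; apply IHn; now apply dfun_partial.
Qed.

Lemma dfun_radial k F : dfun F -> dfun (radial k F).
Proof.
  intros HF; split.
  - apply smooth_Ck; intros; now apply Ck_radial.
  - exists (ord F); now apply order_le_radial, order_le_ord.
Qed.

(** The scaling of the fibre commutes with prolongation: [u_(i+1)] is as linear in the fibre
    as [u_i]. *)
Lemma TDx_radial k F : dfun F -> TDx (radial k F) = radial k (TDx F).
Proof.
  intros HF; apply functional_extensionality; intros p.
  rewrite (proj2 TDx_derivation) by now apply dfun_radial.
  pose proof (order_le_ord F HF) as Hn.
  apply is_derive_unique.
  pose proof (radial_is_derive k F (ord F) (fun t c => p c + t * x_field c p)
    (fun c => x_field c p) 0 HF Hn (fun c t => is_derive_line _ _ _)) as H.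
  cbv beta in H; rewrite (line_0 p (fun c => x_field c p)) in H.
  replace (radial k (TDx F) p) with
    (RInt (fun l => l ^ k * lsum (coords (ord F)) (fun c =>
      scal_jet l (fun c => x_field c p) c * partial c F (scal_jet l p))) 0 1); [exact H|].
  unfold radial; apply RInt_ext; intros l _; f_equal.
  rewrite (proj2 TDx_derivation), (lie_formula _ F (ord F)) by easy.
  apply lsum_ext; intros [|i] _; reflexivity.
Qed.

(** The integrand is the derivative of [l^2 F(x, l u)] in [l]. *)
Lemma radial_homotopy F : dfun F ->
  radial 1 (fadd (fadd F F) (lie scaling_field F)) = F.
Proof.
  intros HF; apply functional_extensionality; intros p.
  pose proof (order_le_ord F HF) as Hn.
  pose (G := fadd (fadd F F) (lie scaling_field F)).
  assert (Hfield : forall c, dfun (scaling_field c))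
    by (intros [|i]; [apply dfun_const | apply dfun_coord]).
  assert (HG : dfun G) by (apply dfun_add; [now apply dfun_add | now apply dfun_lie]).
  assert (HD : forall l, is_derive (fun l => l ^ 2 * F (scal_jet l p)) l
                           (l ^ 1 * G (scal_jet l p))).
  { intros l.
    assert (H1 : is_derive (fun l => F (scal_jet l p)) l (lsum (coords (ord F)) (fun c =>
              scaling_field c p * partial c F (scal_jet l p)))).
    { apply (chain_rule F (ord F) (fun l => scal_jet l p) l (fun c => scaling_field c p)); auto.
      intros [|i]; simpl; [apply (is_derive_const (p X))|].
      unfold fcoord; auto_derive; [easy | ring]. }
    assert (H2 : is_derive (fun l : R => l ^ 2) l (2 * l)) by (auto_derive; [easy | ring]).
    pose proof (is_derive_mult (fun l : R => l ^ 2) (fun l => F (scal_jet l p)) l _ _ H2 H1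
      Rmult_comm) as H.
    replace (l ^ 1 * G (scal_jet l p)) with (2 * l * F (scal_jet l p) + l ^ 2 *
      lsum (coords (ord F)) (fun c => scaling_field c p * partial c F (scal_jet l p)));
      [exact H|].
    unfold G, fadd; rewrite (lie_formula _ F (ord F)) by easy.
    rewrite (lsum_ext _ (fun c => scaling_field c (scal_jet l p) * partial c F (scal_jet l p))
      (fun c => l * (scaling_field c p * partial c F (scal_jet l p)))).
    - rewrite lsum_scal; ring.
    - intros [|i] _; simpl; unfold fconst, fcoord, scal_jet at 1; ring. }
  unfold radial; apply is_RInt_unique.
  replace (F p) with (minus (1 ^ 2 * F (scal_jet 1 p)) (0 ^ 2 * F (scal_jet 0 p))).
  - apply (is_RInt_derive (V := R_CompleteNormedModule) (fun l => l ^ 2 * F (scal_jet l p))).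
    + intros l _; apply HD.
    + intros l _; now apply continuous_integrand.
  - replace (scal_jet 1 p) with p
      by (apply functional_extensionality; intros [|i]; simpl; ring).
    unfold minus, plus, opp; simpl; ring.
Qed.

(** * Null Lagrangians *)

Definition null (F : jfun coord1) : Prop := exists V, dfun V /\ forall p, F p = TDx V p.

Lemma null_ext F G : (forall p, F p = G p) -> null F -> null G.
Proof. intros H [V [HV E]]; exists V; split; [easy|]; intros p; now rewrite <- H. Qed.

Lemma null_zero : null (fun _ => 0).
Proof.
  exists (fconst 0); split; [apply dfun_const|]; intros p.
  now rewrite (D_const _ _ TDx_derivation).
Qed.

Lemma null_add F G : null F -> null G -> null (fun p => F p + G p).
Proof.
  intros [V [HV EV]] [W [HW EW]]; exists (fadd V W); split; [now apply dfun_add|].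
  intros p; rewrite (D_add _ _ TDx_derivation) by easy; unfold fadd; now rewrite EV, EW.
Qed.

Lemma null_scal k F : null F -> null (fun p => k * F p).
Proof.
  intros [V [HV EV]]; exists (fmul (fconst k) V); split; [apply dfun_mul; auto using dfun_const|].
  intros p; rewrite (D_mul _ _ TDx_derivation), (D_const _ _ TDx_derivation)
    by auto using dfun_const.
  unfold fadd, fmul, fconst; rewrite EV; ring.
Qed.

Lemma null_sum (F : nat -> jfun coord1) n : (forall i, (i <= n)%nat -> null (F i)) ->
  null (fun p => sum_f_R0 (fun i => F i p) n).
Proof.
  induction n; intros H; [apply (H 0%nat); lia|].
  simpl; apply null_add; [apply IHn; intros; apply H; lia | apply H; lia].
Qed.

Lemma TDx_dfun f : dfun f -> dfun (TDx f).
Proof. apply (D_dfun _ _ TDx_derivation). Qed.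

Lemma iter_TDx_dfun i f : dfun f -> dfun (Nat.iter i TDx f).
Proof. apply (iter_dfun _ _ TDx_derivation). Qed.

Lemma iter_mTDx_dfun i f : dfun f -> dfun (Nat.iter i mTDx f).
Proof. apply (iter_dfun _ _ mTDx_derivation). Qed.

(** Integration by parts, [j] times. *)
Lemma null_parts j f g : dfun f -> dfun g ->
  null (fun p => f p * Nat.iter j mTDx g p - Nat.iter j TDx f p * g p).
Proof.
  intros Hf Hg; revert f Hf; induction j; intros f Hf.
  - apply (null_ext (fun _ => 0)); [intros p; simpl; ring | apply null_zero].
  - pose (h := Nat.iter j mTDx g).
    assert (Hh : dfun h) by (now apply iter_mTDx_dfun).
    assert (H1 : null (fun p => TDx f p * h p + f p * TDx h p)).
    { exists (fmul f h); split; [now apply dfun_mul|]; intros p.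
      now rewrite (D_mul _ _ TDx_derivation). }
    apply (null_ext (fun p => -1 * (TDx f p * h p + f p * TDx h p) +
      (TDx f p * h p - Nat.iter j TDx (TDx f) p * g p))).
    + intros p; rewrite <- PeanoNat.Nat.iter_succ_r.
      change (Nat.iter (S j) mTDx g p) with (- TDx h p); ring.
    + apply null_add; [now apply null_scal | apply (IHj (TDx f)); now apply TDx_dfun].
Qed.

Lemma null_adjoint A f g : dop_wf A -> dfun f -> dfun g ->
  null (fun p => f p * op_adjoint TDx A g p - op_apply TDx A f p * g p).
Proof.
  intros HA Hf Hg.
  apply (null_ext (fun p => sum_f_R0 (fun i =>
    f p * Nat.iter i mTDx (fmul (op_coef A i) g) p
    - Nat.iter i TDx f p * fmul (op_coef A i) g p) (op_order A))).
  - intros p; unfold op_adjoint, op_apply.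
    rewrite minus_sum, scal_sum, (Rmult_comm _ (g p)), scal_sum.
    f_equal; apply sum_eq; intros i _; [apply Rmult_comm|]; unfold fmul; ring.
  - apply (null_sum (fun i p => _ - _)); intros i Hi; apply null_parts; [easy|].
    apply dfun_mul; [now apply HA | easy].
Qed.

Lemma order_le_drop k V : dfun V -> order_le (S k) V -> partial (U (S k)) V = fconst 0 ->
  order_le k V.
Proof.
  intros HV Hn H0 p q Hpq.
  assert (Hc : forall s t, s < t -> V (upd p (U (S k)) s) = V (upd p (U (S k)) t)).
  { intros s t Hst.
    apply (eq_is_derive (V := R_NormedModule) (fun s => V (upd p (U (S k)) s))); [|easy].
    intros r _; pose proof (is_derive_partial (U (S k)) V (dfun_ex_partial _ V HV) p r) as H.
    rewrite H0 in H; exact H. }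
  transitivity (V (upd p (U (S k)) (q (U (S k))))).
  - rewrite <- (upd_self p (U (S k))) at 1.
    destruct (Rtotal_order (p (U (S k))) (q (U (S k)))) as [H|[->|H]]; [auto | easy|].
    symmetry; auto.
  - apply Hn; intros c Hcl; unfold upd; destruct coord_eq_dec as [->|Hne]; [easy|].
    apply Hpq; destruct c as [|i]; simpl in *; [lia|].
    assert (i <> S k) by congruence; lia.
Qed.

(** A total derivative is affine in the highest jet coordinate that it contains. The product of
    [Z] and the square of a coordinate above the order of [Z] is not, unless [Z] vanishes. *)
Lemma null_multiples_zero Z : dfun Z -> (forall f, dfun f -> null (fmul f Z)) ->
  Z = fconst 0.
Proof.
  intros HR H; pose proof (order_le_ord Z HR) as Hn; set (n := ord Z) in *.
  destruct (H (fmul (fcoord (U (S n))) (fcoord (U (S n))))) as [V [HV EV]];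
    [apply dfun_mul; apply dfun_coord|].
  assert (HRu : forall i p s, (n < i)%nat -> Z (upd p (U i) s) = Z p).
  { intros i p s Hi; apply Hn; intros c Hc; apply upd_other; intros ->; simpl in Hc; lia. }
  assert (Hformula : forall k p, order_le k V ->
            TDx V p = partial X V p + sum_f_R0 (fun i => p (U (S i)) * partial (U i) V p) k).
  { intros k p Hk; rewrite (proj2 TDx_derivation), (lie_formula1 _ V k) by easy.
    unfold x_field, fconst, fcoord; ring. }
  (* If k bounds the order of V, only the last term of TDx V contains u_(k+1). *)
  assert (Haff : forall k p s, order_le k V ->
            TDx V (upd p (U (S k)) s) = TDx V (upd p (U (S k)) 0) + s * partial (U k) V p).
  { intros k p s Hk.
    assert (Hu : forall c s, partial c V (upd p (U (S k)) s) = partial c V p).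
    { intros c t; apply (order_le_partial k c V Hk); intros d Hd; apply upd_other; intros ->.
      simpl in Hd; lia. }
    rewrite !(Hformula k) by easy.
    destruct k as [|k].
    - simpl; rewrite !Hu, !upd_same; ring.
    - rewrite !tech5, !Hu, !upd_same.
      rewrite (sum_eq _ (fun i => p (U (S i)) * partial (U i) V p)).
      + rewrite (sum_eq (fun i => upd p (U (S (S k))) 0 (U (S i)) * _)
          (fun i => p (U (S i)) * partial (U i) V p)); [ring|].
        intros i Hi; rewrite Hu, upd_other; [easy | intros E; injection E; lia].
      + intros i Hi; rewrite Hu, upd_other; [easy | intros E; injection E; lia]. }
  assert (Hdrop : forall d, order_le (n + d) V -> order_le n V).
  { induction d as [|d IH]; [now rewrite PeanoNat.Nat.add_0_r|].
    rewrite PeanoNat.Nat.add_succ_r; intros Hd; apply IH, order_le_drop; [easy..|].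
    apply functional_extensionality; intros p.
    pose proof (Haff _ p 1 Hd) as E.
    rewrite <- !EV in E; unfold fmul, fcoord in E.
    rewrite !upd_other, !HRu in E by (lia || (intros E'; injection E'; lia)).
    unfold fconst; lra. }
  assert (HVn : order_le n V).
  { apply (Hdrop (ord V)), (order_le_mono (ord V)); [lia | now apply order_le_ord]. }
  apply functional_extensionality; intros p; unfold fconst.
  pose proof (Haff n p 1 HVn) as E1; pose proof (Haff n p (-1) HVn) as E2.
  rewrite <- !EV in E1, E2; unfold fmul, fcoord in E1, E2.
  rewrite !upd_same, !HRu in E1, E2 by lia; lra.
Qed.

(** * Evaluation of forms *)

(** A form is evaluated on tuples of vectors with coefficients in the differential functions,
    given by their components along the dual frame. *)
Definition vect : Type := cogen -> jfun coord1.

Fixpoint picks (Vs : list vect) : list (R * (vect * list vect)) :=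
  match Vs with
  | [] => []
  | V :: Vs' => (1, (V, Vs')) :: map (fun m => (- fst m, (fst (snd m), V :: snd (snd m)))) (picks Vs')
  end.

(** Laplace expansion along the leading covector, which suits wedging and derivation; the
    expansion along the first vector is [eval_word_contract]. *)
Fixpoint eval_word (l : list cogen) (Vs : list vect) : jfun coord1 :=
  match l with
  | [] => match Vs with [] => fconst 1 | _ :: _ => fconst 0 end
  | g :: l' => flsum (picks Vs) (fun m =>
      fmul (fconst (fst m)) (fmul (fst (snd m) g) (eval_word l' (snd (snd m)))))
  end.

Definition eval_form (w : form) (Vs : list vect) : jfun coord1 :=
  flsum w (fun m => fmul (fst m) (eval_word (snd m) Vs)).

Lemma eval_word_contract l V Vs G p : NoDup G -> incl l G ->
  eval_word l (V :: Vs) p = lsum G (fun g => V g p *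
    lsum (contract_word g l) (fun m => fst m * eval_word (snd m) Vs p)).
Proof.
  intros HG; revert Vs; induction l as [|h l IH]; intros Vs Hl.
  - simpl; symmetry; apply lsum_zero; intros g _; unfold lsum; simpl; ring.
  - assert (Hh : In h G) by (apply Hl; now left).
    assert (Hl' : incl l G) by (intros g Hg; apply Hl; now right).
    transitivity (V h p * eval_word l Vs p - lsum (picks Vs) (fun m =>
      fst m * (fst (snd m) h p * eval_word l (V :: snd (snd m)) p))).
    { cbn [eval_word picks]; unfold flsum.
      change (lsum (?a :: ?b) ?F) with (F a + lsum b F); cbv beta.
      rewrite lsum_map; unfold fmul, fconst; simpl.
      rewrite (lsum_ext (picks Vs) (fun m => - fst m * _) (fun m => -1 * (fst m *
        (fst (snd m) h p * eval_word l (V :: snd (snd m)) p)))) by (intros; ring).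
      rewrite lsum_scal; ring. }
    rewrite (lsum_ext (picks Vs) _ (fun m => lsum G (fun g => V g p * (fst m * (fst (snd m) h p *
      lsum (contract_word g l) (fun m' => fst m' * eval_word (snd m') (snd (snd m)) p))))))
      by (intros m _; rewrite IH by easy; rewrite <- !lsum_scal; apply lsum_ext; intros; ring).
    rewrite lsum_swap.
    rewrite <- (lsum_pick cogen_eq_dec G h (fun g => V g p * eval_word l Vs p)) by easy.
    unfold Rminus.
    match goal with |- _ + - ?S = _ => replace (- S) with (-1 * S) by ring end.
    rewrite <- lsum_scal, <- lsum_plus; apply lsum_ext; intros g _.
    assert (Htail : lsum (map (fun m => (- fst m, h :: snd m)) (contract_word g l))
                (fun m => fst m * eval_word (snd m) Vs p) =
              - lsum (picks Vs) (fun m => fst m * (fst (snd m) h p * lsum (contract_word g l)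
                  (fun m' => fst m' * eval_word (snd m') (snd (snd m)) p)))).
    { rewrite lsum_map.
      transitivity (lsum (contract_word g l) (fun m' => lsum (picks Vs) (fun m =>
        -1 * (fst m * (fst (snd m) h p * (fst m' * eval_word (snd m') (snd (snd m)) p)))))).
      - apply lsum_ext; intros m' _; cbn [fst snd eval_word]; unfold flsum.
        rewrite <- lsum_scal; apply lsum_ext; intros; unfold fmul, fconst; ring.
      - rewrite lsum_swap.
        match goal with |- _ = - ?S => replace (- S) with (-1 * S) by ring end.
        rewrite <- lsum_scal; apply lsum_ext; intros m _.
        rewrite <- !lsum_scal; apply lsum_ext; intros; ring. }
    cbn [contract_word]; rewrite lsum_app, Htail.
    replace (lsum (picks Vs) (fun m => V g p * (fst m * (fst (snd m) h p *
        lsum (contract_word g l) (fun m' => fst m' * eval_word (snd m') (snd (snd m)) p)))))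
      with (V g p * lsum (picks Vs) (fun m => fst m * (fst (snd m) h p *
        lsum (contract_word g l) (fun m' => fst m' * eval_word (snd m') (snd (snd m)) p))))
      by (rewrite <- lsum_scal; reflexivity).
    match goal with |- context [lsum (picks Vs) ?F] => generalize (lsum (picks Vs) F) end.
    intros S; destruct (cogen_eq_dec g h) as [->|Hne]; destruct cogen_eq_dec as [E|E];
      try congruence; unfold lsum; simpl; ring.
Qed.

Lemma eval_form_contract w V Vs G p : NoDup G -> (forall m, In m w -> incl (snd m) G) ->
  eval_form w (V :: Vs) p = lsum G (fun g => V g p * eval_form (contract g w) Vs p).
Proof.
  intros HG Hw; unfold eval_form, flsum, contract.
  rewrite (lsum_ext G _ (fun g => lsum w (fun m => fst m p * (V g p *
    lsum (contract_word g (snd m)) (fun n => fst n * eval_word (snd n) Vs p))))).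
  - rewrite lsum_swap; apply lsum_ext; intros m Hm; unfold fmul.
    rewrite (eval_word_contract _ V Vs G p HG (Hw m Hm)), lsum_scal; reflexivity.
  - intros g _; rewrite lsum_flat_map, <- lsum_scal; apply lsum_ext; intros m _.
    rewrite lsum_map; unfold fmul; cbn [fst snd]; rewrite <- !lsum_scal; apply lsum_ext; intros; unfold jfun; ring.
Qed.

(** Contractions with the dual frame determine the values on all vectors, by linearity in the
    components. *)
Lemma eval_form_zero w : form_zero w -> forall Vs p, eval_form w Vs p = 0.
Proof.
  intros Hw Vs p; revert w Hw; induction Vs as [|V Vs IH]; intros w Hw.
  - specialize (Hw [] p); simpl in Hw; rewrite <- Hw.
    unfold eval_form, flsum, scalar_part; apply lsum_ext; intros [f [|g l]] _.
    + unfold fmul; simpl; unfold fconst; ring.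
    + unfold fmul; simpl; unfold flsum, lsum; simpl; ring.
  - rewrite (eval_form_contract w V Vs (nodup cogen_eq_dec (flat_map snd w))).
    + apply lsum_zero; intros g _; rewrite IH; [ring|].
      intros gs q; specialize (Hw (gs ++ [g]) q); rewrite fold_right_app in Hw; exact Hw.
    + apply NoDup_nodup.
    + intros m Hm g Hg; apply nodup_In, in_flat_map; eauto.
Qed.

(** Evaluation on such vectors turns the total derivative of forms into that of functions,
    because their components transform as the covectors do. *)
Definition prolonged (V : vect) : Prop :=
  (forall g, dfun (V g)) /\ TDx (V dx) = fconst 0 /\
  forall i, TDx (V (theta i)) = V (theta (S i)).

Lemma in_picks Vs s V r : In (s, (V, r)) (picks Vs) -> In V Vs /\ incl r Vs.
Proof.
  revert s V r; induction Vs as [|W Vs IH]; intros s V r; simpl; [easy|].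
  intros [E|E].
  - injection E as <- <- <-; split; [now left|]; intros x Hx; now right.
  - apply in_map_iff in E as [[s' [V' r']] [E Hin]]; simpl in E; injection E as <- <- <-.
    destruct (IH _ _ _ Hin) as [HV Hr]; split; [now right|].
    intros x [<-|Hx]; [now left | right; auto].
Qed.

Lemma dfun_eval_word l Vs : (forall V, In V Vs -> prolonged V) -> dfun (eval_word l Vs).
Proof.
  revert Vs; induction l as [|h l IH]; intros Vs HVs.
  - destruct Vs; apply dfun_const.
  - apply dfun_flsum; intros [s [V r]] Hin; apply in_picks in Hin as [HV Hr]; simpl.
    apply dfun_mul; [apply dfun_const|]; apply dfun_mul; [now apply HVs|].
    apply IH; auto.
Qed.

Lemma D_flsum {A} (l : list A) F : (forall a, In a l -> dfun (F a)) ->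
  TDx (flsum l F) = flsum l (fun a => TDx (F a)).
Proof.
  intros H; rewrite (proj2 TDx_derivation) by now apply dfun_flsum.
  rewrite lie_flsum by easy; apply functional_extensionality; intros p.
  apply lsum_ext; intros a Ha; now rewrite (proj2 TDx_derivation) by auto.
Qed.

Lemma TDx_eval_word l Vs : (forall V, In V Vs -> prolonged V) ->
  TDx (eval_word l Vs) = flsum (Dx_word l) (fun l' => eval_word l' Vs).
Proof.
  revert Vs; induction l as [|h l IH]; intros Vs HVs.
  - simpl; destruct Vs; apply (D_const _ _ TDx_derivation).
  - cbn [eval_word]; rewrite D_flsum.
    + apply functional_extensionality; intros p; cbn [Dx_word]; unfold flsum at 2.
      rewrite lsum_app, !lsum_map.
      assert (Hcog : forall V, prolonged V ->
                TDx (V h) = flsum (Dx_cogen h) (fun h' => V h')).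
      { intros V [_ [H1 H2]]; destruct h as [|i]; simpl; [exact H1|].
        apply functional_extensionality; intros q; rewrite H2; unfold flsum, lsum; simpl; ring. }
      cbn [eval_word]; unfold flsum at 2 3.
      rewrite (lsum_swap (Dx_cogen h)), (lsum_swap (Dx_word l)), <- lsum_plus.
      apply lsum_ext; intros [s [V r]] Hin; apply in_picks in Hin as [HV Hr]; simpl.
      assert (HV' : forall g, dfun (V g)) by (apply (HVs V HV)).
      assert (Hr' : forall W, In W r -> prolonged W) by auto.
      pose proof (dfun_eval_word l r Hr') as Hd.
      rewrite (D_mul _ _ TDx_derivation), (D_mul _ _ TDx_derivation), (D_const _ _ TDx_derivation)
        by auto using dfun_mul, dfun_const.
      rewrite IH, (Hcog V) by auto.
      unfold fadd, fmul, fconst, flsum; rewrite Rmult_0_l, Rplus_0_l.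
      rewrite !lsum_scal.
      rewrite (lsum_ext (Dx_cogen h) (fun a => V a p * eval_word l r p)
        (fun a => eval_word l r p * V a p)) by (intros; ring).
      rewrite !lsum_scal; ring.
    + intros [s [V r]] Hin; apply in_picks in Hin as [HV Hr]; simpl.
      apply dfun_mul; [apply dfun_const|]; apply dfun_mul; [now apply (HVs V HV)|].
      apply dfun_eval_word; auto.
Qed.

Definition form_wf (w : form) : Prop := forall m, In m w -> dfun (fst m).

Lemma eval_form_scale k w Vs p : eval_form (form_scale k w) Vs p = k * eval_form w Vs p.
Proof.
  unfold eval_form, flsum, form_scale; rewrite lsum_map, <- lsum_scal; apply lsum_ext.
  intros; unfold fmul; simpl; apply Rmult_assoc.
Qed.

Lemma form_wf_scale k w : form_wf w -> form_wf (form_scale k w).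
Proof.
  intros H m Hm; apply in_map_iff in Hm as [n [<- Hn]]; simpl.
  apply (dfun_mul (fconst k)); [apply dfun_const | now apply H].
Qed.

Lemma form_wf_Dx w : form_wf w -> form_wf (Dx_form w).
Proof.
  intros H m Hm; apply in_flat_map in Hm as [n [Hn [<-|Hm]]]; simpl.
  - now apply TDx_dfun, H.
  - apply in_map_iff in Hm as [l [<- _]]; simpl; now apply H.
Qed.

Lemma form_wf_contract g w : form_wf w -> form_wf (contract g w).
Proof.
  intros H m Hm; apply in_flat_map in Hm as [n [Hn Hm]].
  apply in_map_iff in Hm as [[s l] [<- _]]; simpl.
  apply (dfun_mul (fconst s)); [apply dfun_const | now apply H].
Qed.

Lemma dfun_eval_form w Vs : form_wf w -> (forall V, In V Vs -> prolonged V) ->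
  dfun (eval_form w Vs).
Proof. intros Hw HVs; apply dfun_flsum; intros; apply dfun_mul; auto using dfun_eval_word. Qed.

Lemma eval_form_Dx w Vs : form_wf w -> (forall V, In V Vs -> prolonged V) ->
  eval_form (Dx_form w) Vs = TDx (eval_form w Vs).
Proof.
  intros Hw HVs; unfold eval_form at 2; rewrite D_flsum
    by (intros; apply dfun_mul; auto using dfun_eval_word).
  apply functional_extensionality; intros p; unfold eval_form, flsum, Dx_form.
  rewrite lsum_flat_map; apply lsum_ext; intros m Hm.
  rewrite (D_mul _ _ TDx_derivation), TDx_eval_word by auto using dfun_eval_word.
  change (lsum (?a :: ?b) ?F) with (F a + lsum b F); cbv beta.
  rewrite lsum_map; unfold fadd, fmul, flsum; simpl; now rewrite lsum_scal.
Qed.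

Lemma eval_form_iter_mDx i w Vs : form_wf w -> (forall V, In V Vs -> prolonged V) ->
  form_wf (Nat.iter i (fun eta => form_scale (-1) (Dx_form eta)) w) /\
  eval_form (Nat.iter i (fun eta => form_scale (-1) (Dx_form eta)) w) Vs
    = Nat.iter i mTDx (eval_form w Vs).
Proof.
  intros Hw HVs; induction i as [|i [IH1 IH2]]; [easy|]; simpl; split.
  - now apply form_wf_scale, form_wf_Dx.
  - rewrite <- IH2; unfold mTDx at 1; rewrite <- eval_form_Dx by easy.
    apply functional_extensionality; intros p; rewrite eval_form_scale; unfold fopp; ring.
Qed.

(** * Evaluation on evolutionary vector fields *)

(** Prolongation of the evolutionary field with characteristic [f]. *)
Definition evol_vect (f : jfun coord1) : vect :=
  fun g => match g with dx => fconst 0 | theta i => Nat.iter i TDx f end.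

Definition dx_vect : vect := fun g => match g with dx => fconst 1 | theta _ => fconst 0 end.

Lemma prolonged_evol f : dfun f -> prolonged (evol_vect f).
Proof.
  intros Hf; split; [|split].
  - intros [|i]; [apply dfun_const | now apply iter_TDx_dfun].
  - apply (D_const _ _ TDx_derivation).
  - reflexivity.
Qed.

Lemma prolonged_dx : prolonged dx_vect.
Proof.
  split; [|split].
  - intros [|i]; apply dfun_const.
  - apply (D_const _ _ TDx_derivation).
  - intros i; apply (D_const _ _ TDx_derivation).
Qed.

Definition euler_part (w : form) : form :=
  flat_map (fun i =>
    Nat.iter i (fun eta => form_scale (-1) (Dx_form eta)) (contract (theta i) w))
  (seq 0 (S (theta_bound w))).

Lemma eval_euler_part w Vs p : form_wf w -> (forall V, In V Vs -> prolonged V) ->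
  eval_form (euler_part w) Vs p =
    sum_f_R0 (fun i => Nat.iter i mTDx (eval_form (contract (theta i) w) Vs) p) (theta_bound w).
Proof.
  intros Hw HVs; unfold eval_form at 1, flsum, euler_part.
  rewrite lsum_flat_map, <- lsum_seq; apply lsum_ext; intros i _.
  rewrite <- (proj2 (eval_form_iter_mDx i _ Vs (form_wf_contract (theta i) w Hw) HVs)).
  reflexivity.
Qed.

Lemma theta_bound_spec w m i : In m w -> In (theta i) (snd m) -> (i <= theta_bound w)%nat.
Proof.
  intros Hm Hi.
  pose proof (proj1 (list_max_le _ _) (PeanoNat.Nat.le_refl (theta_bound w))) as H.
  rewrite Forall_forall in H; apply H, in_flat_map.
  exists m; split; [easy|]; apply in_map_iff; now exists (theta i).
Qed.

(** Integration by parts moves the powers of D_x back to [f], where they produce the components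
    of its evolutionary field; the sum over [i] is then the contraction of [w] with that field. *)
Lemma null_euler_part w f Vs : form_wf w -> dfun f -> (forall V, In V Vs -> prolonged V) ->
  null (fun p => f p * eval_form (euler_part w) Vs p - eval_form w (evol_vect f :: Vs) p).
Proof.
  intros Hw Hf HVs.
  apply (null_ext (fun p => sum_f_R0 (fun i =>
    f p * Nat.iter i mTDx (eval_form (contract (theta i) w) Vs) p -
    Nat.iter i TDx f p * eval_form (contract (theta i) w) Vs p) (theta_bound w))).
  - intros p; rewrite eval_euler_part by easy.
    rewrite (eval_form_contract w _ Vs (dx :: map theta (seq 0 (S (theta_bound w))))).
    + change (lsum (?a :: ?b) ?F) with (F a + lsum b F); cbv beta.
      rewrite lsum_map, lsum_seq, minus_sum; simpl evol_vect; unfold fconst.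
      rewrite Rmult_0_l, Rplus_0_l; f_equal.
      rewrite scal_sum; apply sum_eq; intros; ring.
    + constructor.
      * rewrite in_map_iff; intros [i [E _]]; discriminate E.
      * apply Injective_map_NoDup; [intros i j E; congruence | apply seq_NoDup].
    + intros m Hm [|i] Hi; [now left|]; right; apply in_map, in_seq.
      pose proof (theta_bound_spec w m i Hm Hi); lia.
  - apply (null_sum (fun i p => _ - _)); intros i _; apply null_parts; [easy|].
    apply dfun_eval_form; [now apply form_wf_contract | easy].
Qed.

Lemma eval_wedge_theta0 w V1 V2 V3 p :
  eval_form (wedge_l (theta 0) w) [V1; V2; V3; dx_vect] p =
    V1 (theta 0) p * eval_form w [V2; V3; dx_vect] p
    - V2 (theta 0) p * eval_form w [V1; V3; dx_vect] p
    + V3 (theta 0) p * eval_form w [V1; V2; dx_vect] p.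
Proof.
  unfold eval_form, flsum, wedge_l; rewrite lsum_map.
  transitivity
    (V1 (theta 0) p * lsum w (fun m => fmul (fst m) (eval_word (snd m) [V2; V3; dx_vect]) p)
    + - V2 (theta 0) p * lsum w (fun m => fmul (fst m) (eval_word (snd m) [V1; V3; dx_vect]) p)
    + V3 (theta 0) p * lsum w (fun m => fmul (fst m) (eval_word (snd m) [V1; V2; dx_vect]) p));
    [|ring].
  rewrite <- !lsum_scal, <- !lsum_plus; apply lsum_ext; intros m _.
  cbn [snd fst eval_word picks map]; unfold fmul, flsum, lsum, fconst; simpl.
  unfold fconst, jfun; ring.
Qed.

(** * Closedness of symplectic operators *)

Definition evol_field (f : jfun coord1) (c : coord1) : jfun coord1 :=
  match c with X => fconst 0 | U i => Nat.iter i TDx f end.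

Definition var_op (A : dop coord1) (f : jfun coord1) : dop coord1 :=
  DOp (op_order A) (fun i => lie (evol_field f) (op_coef A i)).

Lemma evol_field_dfun f : dfun f -> forall c, dfun (evol_field f c).
Proof. intros Hf [|i]; [apply dfun_const | now apply iter_TDx_dfun]. Qed.

Lemma var_op_wf A f : dop_wf A -> dfun f -> dop_wf (var_op A f).
Proof. intros HA Hf i Hi; apply dfun_lie; [now apply evol_field_dfun | now apply HA]. Qed.

Lemma dfun_op_apply A f : dop_wf A -> dfun f -> dfun (op_apply TDx A f).
Proof.
  intros HA Hf; apply (dfun_fsum (fun i => fmul (op_coef A i) (Nat.iter i TDx f))).
  intros i Hi; apply dfun_mul; [now apply HA | now apply iter_TDx_dfun].
Qed.

Lemma dfun_op_adjoint A f : dop_wf A -> dfun f -> dfun (op_adjoint TDx A f).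
Proof.
  intros HA Hf; apply (dfun_fsum (fun i => Nat.iter i mTDx (fmul (op_coef A i) f))).
  intros i Hi; apply iter_mTDx_dfun, dfun_mul; [now apply HA | easy].
Qed.

Lemma lie_evol f a n p : dfun a -> order_le n a ->
  lie (evol_field f) a p = sum_f_R0 (fun j => Nat.iter j TDx f p * partial (U j) a p) n.
Proof.
  intros Ha Hn; rewrite (lie_formula1 _ a n) by easy; simpl evol_field; unfold fconst; ring.
Qed.

Lemma eval_dV_op_form A f g h p : dop_wf A ->
  eval_form (dV (op_form A)) [evol_vect f; evol_vect g; evol_vect h; dx_vect] p =
    g p * op_apply TDx (var_op A f) h p - h p * op_apply TDx (var_op A f) g p
    - f p * op_apply TDx (var_op A g) h p + h p * op_apply TDx (var_op A g) f p
    + f p * op_apply TDx (var_op A h) g p - g p * op_apply TDx (var_op A h) f p.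
Proof.
  intros HA; unfold eval_form, flsum, dV, op_form.
  rewrite lsum_flat_map, lsum_map, lsum_seq.
  rewrite (sum_eq _ (fun i =>
    (g p * (lie (evol_field f) (op_coef A i) p * Nat.iter i TDx h p)
     + - h p * (lie (evol_field f) (op_coef A i) p * Nat.iter i TDx g p))
    + (- f p * (lie (evol_field g) (op_coef A i) p * Nat.iter i TDx h p)
     + h p * (lie (evol_field g) (op_coef A i) p * Nat.iter i TDx f p))
    + (f p * (lie (evol_field h) (op_coef A i) p * Nat.iter i TDx g p)
     + - g p * (lie (evol_field h) (op_coef A i) p * Nat.iter i TDx f p)))).
  - unfold op_apply, var_op; simpl.
    rewrite <- !lsum_seq, !lsum_plus, !lsum_scal; ring.
  - intros i Hi; simpl fst; simpl snd; rewrite lsum_map.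
    rewrite !(lie_evol _ _ (ord (op_coef A i))) by (try apply order_le_ord; now apply HA).
    rewrite <- !lsum_seq.
    set (L := seq 0 (S (ord (op_coef A i)))).
    assert (Hs : forall q : jfun coord1, lsum L (fun j => Nat.iter j TDx q p *
              partial (U j) (op_coef A i) p) =
              lsum L (fun j => partial (U j) (op_coef A i) p * Nat.iter j TDx q p))
      by (intros; apply lsum_ext; intros; ring).
    rewrite !Hs.
    rewrite (lsum_ext L _ (fun j =>
      (g p * Nat.iter i TDx h p - h p * Nat.iter i TDx g p) *
        (partial (U j) (op_coef A i) p * Nat.iter j TDx f p)
      + (h p * Nat.iter i TDx f p - f p * Nat.iter i TDx h p) *
        (partial (U j) (op_coef A i) p * Nat.iter j TDx g p)
      + (f p * Nat.iter i TDx g p - g p * Nat.iter i TDx f p) *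
        (partial (U j) (op_coef A i) p * Nat.iter j TDx h p))).
    + rewrite !lsum_plus, !lsum_scal; ring.
    + intros j _; unfold fmul; cbn [fst snd eval_word picks map].
      unfold flsum, lsum, fmul; simpl; unfold fconst; ring.
Qed.

(** Modulo total derivatives, each of the three terms of the expansion of I(w) along theta^0 is
    the value of w = d_V of the form, and these values agree by antisymmetry. *)
Lemma closed_null A f g h : dop_wf A -> form_zero (deltaV 2 (op_form A)) ->
  dfun f -> dfun g -> dfun h ->
  null (fun p => g p * op_apply TDx (var_op A f) h p - h p * op_apply TDx (var_op A f) g p
    - f p * op_apply TDx (var_op A g) h p + h p * op_apply TDx (var_op A g) f p
    + f p * op_apply TDx (var_op A h) g p - g p * op_apply TDx (var_op A h) f p).
Proof.
  intros HA Hzero Hf Hg Hh.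
  set (w := dV (op_form A)).
  assert (Hw : form_wf w).
  { intros m Hm; apply in_flat_map in Hm as [n [Hn Hm]].
    apply in_map_iff in Hm as [j [<- _]]; simpl; apply dfun_partial.
    apply in_map_iff in Hn as [i [<- Hi]]; simpl; apply HA; apply in_seq in Hi; lia. }
  pose proof (eval_form_zero _ Hzero [evol_vect f; evol_vect g; evol_vect h; dx_vect]) as H0.
  assert (Hp : forall a b, dfun a -> dfun b ->
            forall V, In V [evol_vect a; evol_vect b; dx_vect] -> prolonged V).
  { intros a b Ha Hb V [<-|[<-|[<-|[]]]]; auto using prolonged_evol, prolonged_dx. }
  pose proof (null_euler_part w f _ Hw Hf (Hp g h Hg Hh)) as N1.
  pose proof (null_euler_part w g _ Hw Hg (Hp f h Hf Hh)) as N2.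
  pose proof (null_euler_part w h _ Hw Hh (Hp f g Hf Hg)) as N3.
  apply (null_scal (-1)) in N1; apply (null_scal (-1)) in N3.
  pose proof (null_scal (/ 3) _ (null_add _ _ N1 (null_add _ _ N2 N3))) as N.
  revert N; apply null_ext; intros p; specialize (H0 p).
  change (deltaV 2 (op_form A)) with
    (form_scale (/ INR 3) (wedge_l (theta 0) (euler_part w))) in H0.
  rewrite eval_form_scale, eval_wedge_theta0 in H0.
  change (evol_vect ?q (theta 0) p) with (q p) in H0.
  assert (H1 : f p * eval_form (euler_part w) [evol_vect g; evol_vect h; dx_vect] p
    - g p * eval_form (euler_part w) [evol_vect f; evol_vect h; dx_vect] p
    + h p * eval_form (euler_part w) [evol_vect f; evol_vect g; dx_vect] p = 0).
  { apply Rmult_integral in H0 as [H0|H0]; [|exact H0].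
    exfalso; apply (Rinv_neq_0_compat (INR 3)); [apply not_0_INR; lia | exact H0]. }
  unfold w in *; rewrite !eval_dV_op_form by easy.
  match goal with |- _ = ?E => 
    replace E with (E - / 3 * 0) by ring; rewrite <- H1 at 2 end.
  field.
Qed.

(** Evolutionary fields commute with D_x: the components of their prolongations are obtained
    from one another by D_x. *)
Lemma lie_evol_iter f i a : dfun f -> dfun a ->
  lie (evol_field f) (Nat.iter i TDx a) = Nat.iter i TDx (lie (evol_field f) a).
Proof.
  intros Hf Ha; induction i; [easy|]; simpl.
  rewrite <- IHi; pose proof (iter_TDx_dfun i a Ha) as Hi.
  pose proof (evol_field_dfun f Hf) as He.
  rewrite (proj2 TDx_derivation _ Hi), (proj2 TDx_derivation _ (dfun_lie _ _ He Hi)).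
  apply lie_comm; auto; [apply TDx_derivation|].
  intros [|j]; simpl.
  - now rewrite !lie_const.
  - rewrite lie_coord; simpl; now rewrite <- (proj2 TDx_derivation) by now apply iter_TDx_dfun.
Qed.

Lemma lie_evol_iter_m f i a : dfun f -> dfun a ->
  lie (evol_field f) (Nat.iter i mTDx a) = Nat.iter i mTDx (lie (evol_field f) a).
Proof.
  intros Hf Ha; induction i; [easy|]; simpl.
  rewrite <- IHi; unfold mTDx at 1; rewrite lie_opp.
  pose proof (lie_evol_iter f 1 (Nat.iter i mTDx a) Hf (iter_mTDx_dfun i a Ha)) as E.
  simpl in E; now rewrite E.
Qed.

(** Skew-adjointness is an identity between differential functions, so it can be varied. *)
Lemma var_op_skew A f g p : dop_wf A -> skew_adjoint A -> dfun f -> dfun g ->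
  op_adjoint TDx (var_op A f) g p = - op_apply TDx (var_op A f) g p.
Proof.
  intros HA Hskew Hf Hg.
  pose proof (evol_field_dfun f Hf) as He.
  assert (Hlg : dfun (lie (evol_field f) g)) by now apply dfun_lie.
  assert (E1 : lie (evol_field f) (op_apply TDx A g) p =
            op_apply TDx (var_op A f) g p + op_apply TDx A (lie (evol_field f) g) p).
  { change (op_apply TDx A g) with (fsum (fun i => fmul (op_coef A i) (Nat.iter i TDx g))
      (op_order A)).
    rewrite lie_fsum by (intros j Hj; apply dfun_mul; [now apply HA | now apply iter_TDx_dfun]).
    unfold op_apply; rewrite <- sum_plus; apply sum_eq; intros i Hi.
    rewrite lie_mul, lie_evol_iter by (auto using iter_TDx_dfun; now apply HA); reflexivity. }
  assert (E2 : lie (evol_field f) (op_adjoint TDx A g) p =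
            op_adjoint TDx (var_op A f) g p + op_adjoint TDx A (lie (evol_field f) g) p).
  { change (op_adjoint TDx A g) with (fsum (fun i => Nat.iter i mTDx (fmul (op_coef A i) g))
      (op_order A)).
    rewrite lie_fsum by (intros j Hj; apply iter_mTDx_dfun, dfun_mul; [now apply HA | easy]).
    unfold op_adjoint; rewrite <- sum_plus; apply sum_eq; intros i Hi.
    assert (Hi' : dfun (op_coef A i)) by now apply HA.
    rewrite lie_evol_iter_m, lie_mul by auto using dfun_mul.
    rewrite (iter_add _ _ mTDx_derivation); [reflexivity | apply dfun_mul..]; try easy.
    now apply dfun_lie. }
  assert (E : op_adjoint TDx A g = fopp (op_apply TDx A g))
    by (apply functional_extensionality; intros q; now apply Hskew).
  rewrite E, lie_opp in E2; unfold fopp in E2; rewrite E1, Hskew in E2 by easy; lra.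
Qed.

(** The part of the Frechet derivative of A(h) that comes from the coefficients of [A]: it is
    f |-> M_f(h), for M_f = [var_op A f], read as a differential operator in f. *)
Definition coef_frechet (A : dop coord1) (h : jfun coord1) (N : nat) : dop coord1 :=
  DOp N (fun j => fsum (fun i => fmul (partial (U j) (op_coef A i)) (Nat.iter i TDx h))
                       (op_order A)).

Lemma coef_frechet_wf A h N : dop_wf A -> dfun h -> dop_wf (coef_frechet A h N).
Proof.
  intros HA Hh j _; apply dfun_fsum; intros i Hi.
  apply dfun_mul; [now apply dfun_partial, HA | now apply iter_TDx_dfun].
Qed.

Lemma coef_frechet_apply A h N f p : dop_wf A ->
  (forall i, (i <= op_order A)%nat -> order_le N (op_coef A i)) ->
  op_apply TDx (coef_frechet A h N) f p = op_apply TDx (var_op A f) h p.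
Proof.
  intros HA HN; unfold op_apply, coef_frechet, var_op; simpl.
  rewrite (sum_eq (fun i => lie _ _ p * _) (fun i => lsum (seq 0 (S N)) (fun j =>
    partial (U j) (op_coef A i) p * Nat.iter i TDx h p * Nat.iter j TDx f p))).
  - rewrite <- !lsum_seq, lsum_swap; apply lsum_ext; intros j _.
    unfold fsum; rewrite <- lsum_seq, Rmult_comm, <- lsum_scal; apply lsum_ext; intros.
    unfold fmul; ring.
  - intros i Hi; rewrite (lie_evol f _ N) by (auto; now apply HA).
    rewrite <- lsum_seq, Rmult_comm, <- lsum_scal; apply lsum_ext; intros; ring.
Qed.

(** Closedness, with its three arguments distributed so that one of them only occurs as a
    factor; that factor being arbitrary, it can be removed. *)
Lemma closed_adjoint A N g h : dop_wf A -> skew_adjoint A ->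
  form_zero (deltaV 2 (op_form A)) ->
  (forall i, (i <= op_order A)%nat -> order_le N (op_coef A i)) ->
  dfun g -> dfun h ->
  forall p, op_adjoint TDx (coef_frechet A h N) g p =
    op_apply TDx (var_op A g) h p - op_apply TDx (var_op A h) g p.
Proof.
  intros HA Hskew Hzero HN Hg Hh.
  pose proof (coef_frechet_wf A h N HA Hh) as HC.
  set (Z := fadd (op_adjoint TDx (coef_frechet A h N) g)
    (fadd (op_apply TDx (var_op A h) g) (fopp (op_apply TDx (var_op A g) h)))).
  assert (HZ : Z = fconst 0).
  { apply null_multiples_zero.
    - apply dfun_add; [now apply dfun_op_adjoint|].
      apply dfun_add; [|apply dfun_opp]; apply dfun_op_apply; auto using var_op_wf.
    - intros f Hf.
      pose proof (null_adjoint (coef_frechet A h N) f g HC Hf Hg) as NA.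
      pose proof (closed_null A f g h HA Hzero Hf Hg Hh) as NB.
      pose proof (null_adjoint (var_op A f) g h (var_op_wf A f HA Hf) Hg Hh) as C1.
      pose proof (null_adjoint (var_op A g) f h (var_op_wf A g HA Hg) Hf Hh) as C2.
      pose proof (null_adjoint (var_op A h) f g (var_op_wf A h HA Hh) Hf Hg) as C3.
      (* The terms in which f is differentiated cancel, and those of f itself double. *)
      pose proof (null_scal (/ 2) _ (null_add _ _ (null_scal 2 _ NA) (null_add _ _ NB
        (null_add _ _ (null_scal (-1) _ C1) (null_add _ _ C2 (null_scal (-1) _ C3)))))) as NN.
      revert NN; apply null_ext; intros p.
      rewrite !coef_frechet_apply, !var_op_skew by easy.
      unfold Z, fmul, fadd, fopp; field. }
  intros p; pose proof (f_equal (fun F => F p) HZ) as E; unfold Z, fadd, fopp, fconst in E; lra.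
Qed.

(** * Comparing coefficients *)

Lemma finite_order (B : nat -> jfun coord1) N : (forall i, (i <= N)%nat -> dfun (B i)) ->
  exists n, forall i, (i <= N)%nat -> order_le n (B i).
Proof.
  induction N; intros H.
  - exists (ord (B 0%nat)); intros i Hi; replace i with 0%nat by lia; apply order_le_ord, H; lia.
  - destruct IHN as [n Hn]; [intros; apply H; lia|].
    exists (Nat.max n (ord (B (S N)))); intros i Hi.
    destruct (PeanoNat.Nat.eq_dec i (S N)) as [->|Hne].
    + apply (order_le_mono (ord (B (S N)))); [lia | apply order_le_ord, H; lia].
    + apply (order_le_mono n); [lia | apply Hn; lia].
Qed.

(** An operator that annihilates a jet coordinate beyond the order of its coefficients
    vanishes: the derivatives of that coordinate take arbitrary values. *)
Lemma op_zero (B : nat -> jfun coord1) N : (forall i, (i <= N)%nat -> dfun (B i)) ->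
  (forall g, dfun g -> forall p, sum_f_R0 (fun i => B i p * Nat.iter i TDx g p) N = 0) ->
  forall i, (i <= N)%nat -> B i = fconst 0.
Proof.
  intros HB H i Hi; destruct (finite_order B N HB) as [n Hn].
  apply functional_extensionality; intros p.
  (* Same coefficients as at p, while D^j of u_(n+1) is 1 for j = i and 0 otherwise. *)
  pose (q := fun c => match c with X => p X | U j =>
    if Compare_dec.le_dec j n then p (U j)
    else if PeanoNat.Nat.eq_dec j (S n + i) then 1 else 0 end).
  assert (Hq : forall j, (j <= N)%nat -> B j q = B j p).
  { intros j Hj; apply (Hn j Hj); intros [|k] Hk; [easy|]; simpl in *.
    destruct Compare_dec.le_dec; [easy | lia]. }
  specialize (H (fcoord (U (S n))) (dfun_coord _) q).
  rewrite (sum_eq _ (fun j => (if PeanoNat.Nat.eq_dec j i then 1 else 0) * B j p)) in H.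
  - rewrite <- lsum_seq in H.
    rewrite (lsum_pick PeanoNat.Nat.eq_dec) in H; [exact H | apply seq_NoDup | apply in_seq; lia].
  - intros j Hj; rewrite Hq by easy.
    assert (Hit : forall k, Nat.iter k TDx (fcoord (U (S n))) = fcoord (U (S n + k))).
    { induction k; simpl; [now rewrite PeanoNat.Nat.add_0_r|].
      rewrite IHk, (proj2 TDx_derivation), lie_coord by apply dfun_coord.
      simpl; do 2 f_equal; lia. }
    rewrite Hit; unfold fcoord, q.
    destruct Compare_dec.le_dec, (PeanoNat.Nat.eq_dec (S n + j) (S n + i)),
      (PeanoNat.Nat.eq_dec j i); lia || ring.
Qed.

(** * A potential for a symplectic operator *)

(** The coefficients beyond the order of an operator are arbitrary; they are set to zero in
    order to compare operators coefficient by coefficient. *)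
Definition cut (A : dop coord1) (i : nat) : jfun coord1 :=
  if Compare_dec.le_dec i (op_order A) then op_coef A i else fconst 0.

Lemma dfun_cut A i : dop_wf A -> dfun (cut A i).
Proof.
  intros HA; unfold cut; destruct Compare_dec.le_dec; [now apply HA | apply dfun_const].
Qed.

Lemma sum_cut A (F : nat -> R) N p : (op_order A <= N)%nat ->
  sum_f_R0 (fun i => op_coef A i p * F i) (op_order A) = sum_f_R0 (fun i => cut A i p * F i) N.
Proof.
  intros HN; rewrite (sum_bound (fun i => cut A i p * F i) N (op_order A)).
  - apply sum_eq; intros i Hi; unfold cut; destruct Compare_dec.le_dec; [easy | lia].
  - intros i Hi; unfold cut; destruct Compare_dec.le_dec; [lia | unfold fconst; ring].
  - intros i Hi; unfold cut; destruct Compare_dec.le_dec; [lia | unfold fconst; ring].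
Qed.

Lemma adjoint_cut A N g p : (op_order A <= N)%nat ->
  op_adjoint TDx A g p = op_adjoint TDx (DOp N (cut A)) g p.
Proof.
  intros HN; unfold op_adjoint; simpl.
  rewrite (sum_bound _ N (op_order A)).
  - apply sum_eq; intros i Hi; unfold cut; destruct Compare_dec.le_dec; [easy | lia].
  - intros i Hi; unfold cut; destruct Compare_dec.le_dec; [lia|].
    replace (fun q => fconst 0 q * g q) with (fconst (C := coord1) 0).
    + change (fun g0 : jfun coord1 => fopp (TDx g0)) with mTDx.
      now rewrite (iter_zero _ _ mTDx_derivation).
    + apply functional_extensionality; intros q; unfold fconst; ring.
  - intros i Hi; unfold cut; destruct Compare_dec.le_dec; [lia|].
    replace (fun q => fconst 0 q * g q) with (fconst (C := coord1) 0).
    + change (fun g0 : jfun coord1 => fopp (TDx g0)) with mTDx.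
      now rewrite (iter_zero _ _ mTDx_derivation).
    + apply functional_extensionality; intros q; unfold fconst; ring.
Qed.

Lemma op_adjoint_add N B B' g p : dfun g -> (forall i, dfun (B i)) -> (forall i, dfun (B' i)) ->
  op_adjoint TDx (DOp N (fun i => fadd (B i) (B' i))) g p =
    op_adjoint TDx (DOp N B) g p + op_adjoint TDx (DOp N B') g p.
Proof.
  intros Hg HB HB'; unfold op_adjoint; simpl; rewrite <- sum_plus; apply sum_eq; intros i _.
  transitivity (Nat.iter i mTDx (fadd (fmul (B i) g) (fmul (B' i) g)) p).
  - replace (fadd (fmul (B i) g) (fmul (B' i) g)) with (fmul (fadd (B i) (B' i)) g);
      [reflexivity|].
    apply functional_extensionality; intros q; unfold fadd, fmul; ring.
  - rewrite (iter_add _ _ mTDx_derivation) by auto using dfun_mul; reflexivity.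
Qed.

Section Potential.
Context (A : dop coord1) (HA : dop_wf A) (Hskew : skew_adjoint A)
  (Hclosed : form_zero (deltaV 2 (op_form A))).
Context (N : nat) (HN : (op_order A <= N)%nat)
  (HordN : forall i, (i <= op_order A)%nat -> order_le N (op_coef A i)).

Let u0 : jfun coord1 := fcoord (U 0).

Lemma iter_u0 i : Nat.iter i TDx u0 = fcoord (U i).
Proof.
  induction i; [easy|]; simpl; rewrite IHi, (proj2 TDx_derivation), lie_coord by apply dfun_coord.
  reflexivity.
Qed.

Let K : jfun coord1 := op_apply TDx A u0.

Lemma dfun_K : dfun K.
Proof. apply dfun_op_apply; [easy | apply dfun_coord]. Qed.

Lemma partial_K j : (j <= N)%nat ->
  partial (U j) K = fadd (op_coef (coef_frechet A u0 N) j) (cut A j).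
Proof.
  intros Hj; apply functional_extensionality; intros p; apply partial_unique.
  pose proof (fun i Hi => is_derive_partial (U j) (fmul (op_coef A i) (Nat.iter i TDx u0))
    (dfun_ex_partial _ _ (dfun_mul _ _ (HA i Hi) (iter_TDx_dfun i u0 (dfun_coord _)))) p
    (p (U j))) as H.
  rewrite upd_self in H.
  assert (Hsum : forall n, (n <= op_order A)%nat ->
    is_derive (fun s => sum_f_R0 (fun i =>
        fmul (op_coef A i) (Nat.iter i TDx u0) (upd p (U j) s)) n) (p (U j))
      (sum_f_R0 (fun i => partial (U j) (fmul (op_coef A i) (Nat.iter i TDx u0)) p) n)).
  { induction n; intros Hn; [apply (H 0%nat Hn)|].
    apply (is_derive_plus (fun s => sum_f_R0 (fun i =>
        fmul (op_coef A i) (Nat.iter i TDx u0) (upd p (U j) s)) n)); [apply IHn; lia | now apply H]. }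
  specialize (Hsum _ (PeanoNat.Nat.le_refl _)).
  replace (fadd (op_coef (coef_frechet A u0 N) j) (cut A j) p) with
    (sum_f_R0 (fun i => partial (U j) (fmul (op_coef A i) (Nat.iter i TDx u0)) p) (op_order A));
    [exact Hsum|].
  unfold fadd, coef_frechet, fsum; simpl.
  rewrite (sum_eq _ (fun i => fmul (partial (U j) (op_coef A i)) (Nat.iter i TDx u0) p +
    op_coef A i p * (if PeanoNat.Nat.eq_dec i j then 1 else 0))).
  - rewrite sum_plus; f_equal.
    rewrite (sum_cut A _ N) by easy.
    rewrite <- lsum_seq, <- (lsum_pick PeanoNat.Nat.eq_dec (seq 0 (S N)) j (fun i => cut A i p)).
    + apply lsum_ext; intros; ring.
    + apply seq_NoDup.
    + apply in_seq; lia.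
  - intros i Hi; rewrite partial_mul;
      [|apply dfun_ex_partial, HA, Hi | apply dfun_ex_partial, iter_TDx_dfun, dfun_coord].
    rewrite iter_u0, partial_coord; unfold fadd, fmul, fconst, fcoord.
    destruct coord_eq_dec as [E|E], PeanoNat.Nat.eq_dec as [E'|E']; congruence.
Qed.

(** With [u_0] for the third argument, closedness says that the Frechet derivative of [K] is
    self-adjoint up to twice [A] and the derivative of [A] along the scaling of the fibre. *)
Lemma closed_coefs i : (i <= N)%nat ->
  fadd (fadd (cut A i) (cut A i)) (lie scaling_field (cut A i)) =
    fadd (partial (U i) K)
      (fopp (op_adj_coef TDx (DOp N (fun j => partial (U j) K)) i)).
Proof.
  intros Hi.
  assert (HdK : forall j, dfun (partial (U j) K)) by (intros; apply dfun_partial, dfun_K).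
  assert (Hscal : forall c, dfun (scaling_field c))
    by (intros [|k]; [apply dfun_const | apply dfun_coord]).
  assert (Hcut : forall j, dfun (cut A j)) by (intros; now apply dfun_cut).
  assert (HwK : dop_wf (DOp N (fun j => partial (U j) K))) by (intros j _; apply HdK).
  pose (B := fun i => fadd (fadd (fadd (cut A i) (cut A i)) (lie scaling_field (cut A i)))
    (fopp (fadd (partial (U i) K)
      (fopp (op_adj_coef TDx (DOp N (fun j => partial (U j) K)) i))))).
  assert (HB : B i = fconst 0).
  { apply (op_zero B N); [| |easy].
    - intros j Hj; unfold B.
      apply dfun_add; [apply dfun_add; [apply dfun_add|]|apply dfun_opp, dfun_add]; auto.
      + apply dfun_lie; auto.
      + apply dfun_opp; now apply (op_adj_coef_dfun _ _ TDx_derivation).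
    - intros g Hg p.
      pose proof (closed_adjoint A N g u0 HA Hskew Hclosed HordN Hg (dfun_coord _) p) as E.
      rewrite <- (coef_frechet_apply A u0 N g p HA HordN) in E.
      set (CF := coef_frechet A u0 N) in *.
      assert (HCF : forall j, dfun (op_coef CF j)).
      { intros j; apply dfun_fsum; intros k Hk.
        apply dfun_mul; [now apply dfun_partial, HA | apply iter_TDx_dfun, dfun_coord]. }
      assert (EK : op_adjoint TDx (DOp N (fun j => partial (U j) K)) g p =
                op_adjoint TDx CF g p - op_apply TDx A g p).
      { replace (op_adjoint TDx (DOp N (fun j => partial (U j) K)) g p) with
          (op_adjoint TDx (DOp N (fun j => fadd (op_coef CF j) (cut A j))) g p).
        - rewrite op_adjoint_add, <- adjoint_cut by auto.
          rewrite Hskew by easy; unfold CF at 2; unfold coef_frechet; simpl.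
          unfold CF, coef_frechet; simpl; ring.
        - unfold op_adjoint; simpl; apply sum_eq; intros j Hj; now rewrite partial_K. }
      rewrite (op_adjoint_normal _ _ TDx_derivation N) in EK by easy.
      assert (EY : op_apply TDx (var_op A u0) g p =
                sum_f_R0 (fun j => lie scaling_field (cut A j) p * Nat.iter j TDx g p) N).
      { unfold op_apply, var_op; simpl.
        rewrite (sum_bound (fun j => lie scaling_field (cut A j) p * _) N (op_order A)).
        - apply sum_eq; intros j Hj; f_equal; unfold cut; destruct Compare_dec.le_dec; [|lia].
          rewrite !(lie_formula1 _ _ N) by (auto; now apply HA).
          f_equal; apply sum_eq; intros k _; simpl; now rewrite iter_u0.
        - intros j Hj; unfold cut; destruct Compare_dec.le_dec; [lia|]; rewrite lie_const; unfold fconst; ring.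
        - intros j Hj; unfold cut; destruct Compare_dec.le_dec; [lia|].
          rewrite lie_const; unfold fconst; ring. }
      assert (EA : op_apply TDx A g p = sum_f_R0 (fun j => cut A j p * Nat.iter j TDx g p) N)
        by (unfold op_apply; now apply sum_cut).
      assert (EF : op_apply TDx CF g p =
                sum_f_R0 (fun j => partial (U j) K p * Nat.iter j TDx g p) N
                - op_apply TDx A g p).
      { rewrite EA, <- minus_sum; unfold op_apply; apply sum_eq; intros j Hj.
        rewrite partial_K by easy; fold CF; unfold fadd; ring. }
      rewrite (sum_eq _ (fun j => (cut A j p * Nat.iter j TDx g p +
          cut A j p * Nat.iter j TDx g p + lie scaling_field (cut A j) p * Nat.iter j TDx g p)
        + (op_adj_coef TDx (DOp N (fun j => partial (U j) K)) j p * Nat.iter j TDx g p +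
           partial (U j) K p * Nat.iter j TDx g p * -1)))
        by (intros; unfold B, fadd, fopp; ring).
      rewrite !sum_plus, <- scal_sum, <- EY, <- EA, EK, E, EF; ring. }
  apply functional_extensionality; intros p.
  pose proof (f_equal (fun F => F p) HB) as E; unfold B, fadd, fopp, fconst in *; lra.
Qed.

(** This is - int_0^1 l A[l u](u) dl, up to sign the contraction of the symplectic form with
    the scaling field. The factor l is part of K at (x, l u), whence the weight 0. *)
Definition potential : jfun coord1 := fopp (radial 0 K).

Lemma dfun_potential : dfun potential.
Proof. apply dfun_opp, dfun_radial, dfun_K. Qed.

Lemma fopp_involutive (f : jfun coord1) : fopp (fopp f) = f.
Proof. apply functional_extensionality; intros p; unfold fopp; ring. Qed.

Lemma partial_potential i : partial (U i) potential = fopp (radial 1 (partial (U i) K)).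
Proof.
  unfold potential; rewrite fopp_mul, partial_mul, partial_const, partial_radial.
  - apply functional_extensionality; intros p; unfold fadd, fmul, fopp, fconst; ring.
  - apply dfun_K.
  - apply dfun_ex_partial, dfun_const.
  - apply dfun_ex_partial, dfun_radial, dfun_K.
Qed.

(** Radial integration commutes with total derivatives and hence with passage to adjoint
    coefficients; the homotopy formula recovers [A] from [closed_coefs]. *)
Lemma potential_coefs i : (i <= N)%nat ->
  cut A i = fadd (op_adj_coef TDx (DOp N (fun j => partial (U j) potential)) i)
                 (fopp (partial (U i) potential)).
Proof.
  intros Hi.
  assert (HdK : forall j, dfun (partial (U j) K)) by (intros; apply dfun_partial, dfun_K).
  assert (Hadj : forall j, dfun (adj_coef TDx j (partial (U j) K) i))
    by (intros; now apply (dfun_adj_coef _ _ TDx_derivation)).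
  rewrite <- (radial_homotopy (cut A i)) by now apply dfun_cut.
  rewrite closed_coefs by easy.
  rewrite radial_add by (auto; apply dfun_opp; apply dfun_fsum; auto).
  rewrite partial_potential, fopp_involutive.
  assert (E : op_adj_coef TDx (DOp N (fun j => partial (U j) potential)) i =
            fopp (radial 1 (op_adj_coef TDx (DOp N (fun j => partial (U j) K)) i))).
  { unfold op_adj_coef; simpl.
    assert (Hn : forall n, radial 1 (fsum (fun j => adj_coef TDx j (partial (U j) K) i) n)
              = fsum (fun j => radial 1 (adj_coef TDx j (partial (U j) K) i)) n).
    { induction n; [easy|]; rewrite !fsum_S, radial_add, IHn; auto; apply dfun_fsum; auto. }
    rewrite Hn; apply functional_extensionality; intros p; unfold fopp, fsum.
    match goal with |- _ = - ?S => replace (- S) with (-1 * S) by ring end.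
    rewrite scal_sum; apply sum_eq; intros j _; rewrite partial_potential.
    rewrite (adj_coef_intertwine (fun f => fopp (radial 1 f)) TDx _ TDx TDx_derivation).
    - unfold fopp; ring.
    - intros f Hf; rewrite (D_opp _ _ TDx_derivation), TDx_radial by auto using dfun_radial.
      reflexivity.
    - now rewrite radial_zero, fopp_const0.
    - intros f Hf; now rewrite radial_opp.
    - intros f g Hf Hg; rewrite radial_add by easy.
      apply functional_extensionality; intros q; unfold fopp, fadd; ring.
    - apply HdK. }
  rewrite E, radial_opp by (apply dfun_fsum; auto).
  apply functional_extensionality; intros p; unfold fadd; ring.
Qed.

End Potential.

(** * The variational principle in two independent variables *)

Lemma Euler2_formula L n p : dfun L -> order_le n L ->
  Euler2 L p = sum_f_R0 (fun a => sum_f_R0 (fun i =>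
    Nat.iter i mTDx2 (Nat.iter a mTDt2 (partial (W a i) L)) p) n) n.
Proof.
  intros HL Hn; pose proof (order_le_ord L HL) as Ho.
  assert (H0 : forall a i, (ord L < a + i)%nat \/ (n < a + i)%nat ->
            Nat.iter i mTDx2 (Nat.iter a mTDt2 (partial (W a i) L)) p = 0).
  { intros a i Hai; replace (partial (W a i) L) with (fconst (C := coord2) 0).
    - now rewrite (iter_zero _ _ mTDt2_derivation), (iter_zero _ _ mTDx2_derivation).
    - symmetry; destruct Hai; [apply (partial_above (ord L)) | apply (partial_above n)]; easy. }
  unfold Euler2; rewrite (sum_bound _ (ord L) n).
  - apply sum_eq; intros a _; apply sum_bound; intros i Hi; apply H0; lia.
  - intros a Ha; apply sum_eq_R0; intros i _; apply H0; lia.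
  - intros a Ha; apply sum_eq_R0; intros i _; apply H0; lia.
Qed.

Lemma lift_index_out a i : (a <> 0)%nat -> forall c, lift_index c <> W a i.
Proof. intros Ha [|j]; simpl; congruence. Qed.

Lemma partial_lift_0 i f : partial (W 0 i) (lift f) = lift (partial (U i) f).
Proof.
  rewrite lift_reindex; apply (partial_reindex lift_index lift_index_inj (U i)).
Qed.

Lemma partial_lift_t a i f : (a <> 0)%nat -> partial (W a i) (lift f) = fconst 0.
Proof. intros Ha; rewrite lift_reindex; now apply partial_reindex_out, lift_index_out. Qed.

Lemma iter_TDx2_u_t i : Nat.iter i TDx2 u_t = fcoord (W 1 i).
Proof.
  induction i; [easy|]; simpl; rewrite IHi, (proj2 TDx2_derivation), lie_coord by apply dfun_coord.
  reflexivity.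
Qed.

Lemma iter_TDx2_lift i f : dfun f -> Nat.iter i TDx2 (lift f) = lift (Nat.iter i TDx f).
Proof.
  intros Hf; apply (iter_intertwine lift TDx TDx2); auto using TDx2_lift, TDx_dfun.
Qed.

Lemma iter_mTDx2_lift i f : dfun f -> Nat.iter i mTDx2 (lift f) = lift (Nat.iter i mTDx f).
Proof.
  intros Hf; apply (iter_intertwine lift mTDx mTDx2); auto using mTDx2_lift.
  intros g Hg; now apply (iter_mTDx_dfun 1).
Qed.

(** D_t of a function of (x, u, u_x, ...) is its Frechet derivative applied to u_t. *)
Lemma TDt2_lift Q n p : dfun Q -> order_le n Q ->
  TDt2 (lift Q) p = sum_f_R0 (fun i => lift (partial (U i) Q) p * Nat.iter i TDx2 u_t p) n.
Proof.
  intros HQ Hn; rewrite (proj2 TDt2_derivation) by now apply dfun_lift.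
  rewrite (lie_formula2 _ _ n) by auto using dfun_lift, order_le_lift.
  simpl t_field2; unfold fconst; rewrite Rmult_0_l, Rmult_1_l.
  rewrite (sum_bound _ n 0).
  - replace (partial T2 (lift Q) p) with 0.
    + simpl sum_f_R0 at 1; rewrite !Rplus_0_l; apply sum_eq; intros i _.
      rewrite partial_lift_0, iter_TDx2_u_t; unfold fcoord; ring.
    + rewrite lift_reindex, partial_reindex_out; [easy | now intros [|i]].
  - intros a Ha; apply sum_eq_R0; intros i _.
    rewrite partial_lift_t by lia; unfold fconst; ring.
  - intros a Ha; apply sum_eq_R0; intros i _.
    rewrite partial_lift_t by lia; unfold fconst; ring.
Qed.

Definition lagrangian (Q G : jfun coord1) : jfun coord2 := fadd (fmul (lift Q) u_t) (lift G).

Lemma dfun_u_t : dfun u_t.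
Proof. apply (dfun_coord (W 1 0)). Qed.

Lemma dfun_lagrangian Q G : dfun Q -> dfun G -> dfun (lagrangian Q G).
Proof.
  intros HQ HG; apply dfun_add; [apply dfun_mul; [now apply dfun_lift | apply dfun_u_t]|].
  now apply dfun_lift.
Qed.

Lemma partial_lagrangian Q G a i : dfun Q -> dfun G ->
  partial (W a i) (lagrangian Q G) =
    match a with
    | 0%nat => fadd (fmul (lift (partial (U i) Q)) u_t) (lift (partial (U i) G))
    | 1%nat => match i with 0%nat => lift Q | S _ => fconst 0 end
    | _ => fconst 0
    end.
Proof.
  intros HQ HG.
  pose proof (dfun_ex_partial (W a i) _ (dfun_lift Q HQ)) as EQ.
  pose proof (dfun_ex_partial (W a i) _ (dfun_lift G HG)) as EG.
  pose proof (dfun_ex_partial (W a i) _ dfun_u_t) as Eu.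
  unfold lagrangian; rewrite partial_add, partial_mul by auto using ex_partial_mul.
  change u_t with (fcoord (W 1 0)) at 2; rewrite partial_coord.
  apply functional_extensionality; intros p; unfold fadd, fmul, fconst.
  destruct a as [|a].
  - rewrite !partial_lift_0; destruct coord_eq_dec; [congruence | ring].
  - rewrite !partial_lift_t by lia; unfold fconst.
    destruct a, i; destruct coord_eq_dec; congruence || ring.
Qed.

(** The part of the Lagrangian that is linear in [u_t] has for Euler expression the adjoint
    Frechet derivative of [Q] minus the Frechet derivative itself, which comes from [- D_t Q]. *)
Lemma Euler2_lagrangian Q G n p : dfun Q -> dfun G -> order_le n Q ->
  Euler2 (lagrangian Q G) p =
    op_adjoint TDx2 (DOp n (fun i => lift (partial (U i) Q))) u_t p
    - op_apply TDx2 (DOp n (fun i => lift (partial (U i) Q))) u_t p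
    + lift (Euler G) p.
Proof.
  intros HQ HG Hn.
  (* The successor makes room for the coordinate u_t, which has level 1. *)
  set (N := S (Nat.max n (ord G))).
  assert (HnQ : order_le N Q) by (apply (order_le_mono n); [lia | easy]).
  assert (HnG : order_le N G).
  { apply (order_le_mono (ord G)); [lia | now apply order_le_ord]. }
  assert (HN1 : (1 <= N)%nat) by (unfold N; lia); clearbody N.
  rewrite (Euler2_formula _ N).
  2: now apply dfun_lagrangian.
  2: { apply order_le_add; [apply order_le_mul|]; try now apply order_le_lift.
       intros q r H; apply H; exact HN1. }
  assert (Hpart : forall i, dfun (fmul (lift (partial (U i) Q)) u_t) /\
                       dfun (lift (partial (U i) G))).
  { intros i; split; [apply dfun_mul; [|apply dfun_u_t]|]; now apply dfun_lift, dfun_partial. }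
  assert (Habove : forall k i, order_le k Q -> (k < i)%nat ->
            Nat.iter i mTDx2 (fmul (lift (partial (U i) Q)) u_t) p = 0).
  { intros k i Hk Hi; rewrite (partial_U_above k) by easy.
    replace (fmul (lift (fconst 0)) u_t) with (fconst (C := coord2) 0).
    - now rewrite (iter_zero _ _ mTDx2_derivation).
    - apply functional_extensionality; intros q; unfold fmul, lift, fconst; ring. }
  rewrite (sum_bound _ N 1).
  - simpl sum_f_R0 at 1.
    assert (T0 : sum_f_R0 (fun i => Nat.iter i mTDx2 (partial (W 0 i) (lagrangian Q G)) p) N =
              op_adjoint TDx2 (DOp n (fun i => lift (partial (U i) Q))) u_t p
              + lift (Euler G) p).
    { rewrite (sum_eq _ (fun i => Nat.iter i mTDx2 (fmul (lift (partial (U i) Q)) u_t) p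
                                + lift (Nat.iter i mTDx (partial (U i) G)) p)).
      - rewrite sum_plus; f_equal.
        + unfold op_adjoint; simpl; apply sum_bound.
          * intros i Hi; now apply (Habove N).
          * intros i Hi; now apply (Habove n).
        + rewrite (Euler_formula G N) by easy; reflexivity.
      - intros i _; rewrite partial_lagrangian by easy.
        destruct (Hpart i); rewrite (iter_add _ _ mTDx2_derivation) by easy.
        rewrite iter_mTDx2_lift by now apply dfun_partial.
        reflexivity. }
    assert (T1 : sum_f_R0 (fun i => Nat.iter i mTDx2
                (mTDt2 (partial (W 1 i) (lagrangian Q G))) p) N =
              - op_apply TDx2 (DOp n (fun i => lift (partial (U i) Q))) u_t p).
    { rewrite (sum_bound _ N 0).
      - simpl; rewrite partial_lagrangian by easy; unfold mTDt2, fopp.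
        rewrite (TDt2_lift Q n) by easy; reflexivity.
      - intros i Hi; rewrite partial_lagrangian by easy; destruct i; [lia|].
        pose proof (iter_zero _ _ mTDt2_derivation 1) as E; simpl Nat.iter in E; rewrite E.
        now rewrite (iter_zero _ _ mTDx2_derivation).
      - intros i Hi; rewrite partial_lagrangian by easy; destruct i; [lia|].
        pose proof (iter_zero _ _ mTDt2_derivation 1) as E; simpl Nat.iter in E; rewrite E.
        now rewrite (iter_zero _ _ mTDx2_derivation). }
    simpl Nat.iter; rewrite T0, T1; ring.
  - intros a Ha; apply sum_eq_R0; intros i _; rewrite partial_lagrangian by easy.
    destruct a as [|[|a]]; [lia | lia |].
    now rewrite (iter_zero _ _ mTDt2_derivation), (iter_zero _ _ mTDx2_derivation).
  - intros a Ha; apply sum_eq_R0; intros i _; rewrite partial_lagrangian by easy.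
    destruct a as [|[|a]]; [lia | lia |].
    now rewrite (iter_zero _ _ mTDt2_derivation), (iter_zero _ _ mTDx2_derivation).
Qed.

Lemma adj_coef_lift j q i : dfun q -> adj_coef TDx2 j (lift q) i = lift (adj_coef TDx j q i).
Proof.
  intros Hq; apply (adj_coef_intertwine lift TDx _ TDx2 TDx_derivation); auto using TDx2_lift.
Qed.

Theorem symplectic_potential A : symplectic_op A -> exists Q N,
  dfun Q /\ order_le N Q /\ (op_order A <= N)%nat /\
  forall i, (i <= N)%nat ->
    cut A i = fadd (op_adj_coef TDx (DOp N (fun j => partial (U j) Q)) i)
                   (fopp (partial (U i) Q)).
Proof.
  intros [HA [Hskew [_ Hclosed]]].
  destruct (finite_order (op_coef A) (op_order A) HA) as [n Hn].
  pose proof (dfun_potential A HA) as HQ.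
  pose (N := Nat.max (op_order A) (Nat.max n (ord (potential A)))).
  exists (potential A), N; split; [easy|]; split; [|split].
  - apply (order_le_mono (ord (potential A))); [lia | now apply order_le_ord].
  - lia.
  - intros i Hi; apply potential_coefs; auto; [lia|].
    intros j Hj; apply (order_le_mono n); [lia | now apply Hn].
Qed.

Lemma frechet_apply Q N f p : dfun Q -> order_le N Q ->
  op_apply TDx (frechet Q) f p = sum_f_R0 (fun i => partial (U i) Q p * Nat.iter i TDx f p) N.
Proof.
  intros HQ HN; unfold op_apply; simpl; apply sum_bound; intros i Hi.
  - rewrite (partial_U_above (ord Q)) by auto using order_le_ord; unfold fconst; ring.
  - rewrite (partial_U_above N) by easy; unfold fconst; ring.
Qed.

Lemma frechet_adjoint Q N f p : dfun Q -> order_le N Q ->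
  op_adjoint TDx (frechet Q) f p = op_adjoint TDx (DOp N (fun j => partial (U j) Q)) f p.
Proof.
  intros HQ HN; unfold op_adjoint; simpl.
  assert (H0 : forall i, partial (U i) Q = fconst 0 ->
    Nat.iter i (fun g => fopp (TDx g)) (fun q => partial (U i) Q q * f q) p = 0).
  { intros i E; rewrite E; replace (fun q => fconst 0 q * f q) with (fconst (C := coord1) 0).
    - change (fun g : jfun coord1 => fopp (TDx g)) with mTDx.
      now rewrite (iter_zero _ _ mTDx_derivation).
    - apply functional_extensionality; intros q; unfold fconst; ring. }
  apply sum_bound; intros i Hi; apply H0.
  - apply (partial_U_above (ord Q)); auto using order_le_ord.
  - now apply (partial_U_above N).
Qed.

Theorem theorem8p3 :
  forall (H0 H1 H2 : jfun coord1) (D0 : dop coord1),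
    dfun H0 -> dfun H1 -> dfun H2 ->
    hamiltonian_op D0 ->
    (forall p, TDx (Euler H1) p = op_apply TDx D0 (Euler H0) p) ->
    (forall p, op_apply TDx D0 (Euler H1) p = TDx (Euler H2) p) ->
    (forall p, op_apply TDx (op_subst_ux D0) (subst_ux (Euler H1)) p
               = - Euler (subst_ux H2) p) /\
    (symplectic_op (op_subst_ux D0) ->
       variational_op (op_lift (op_subst_ux D0)) (subst_ux (Euler H1)) /\
       exists Q : jfun coord1,
         dfun Q /\
         (forall f, dfun f -> forall p,
            op_apply TDx (op_subst_ux D0) f p
            = op_adjoint TDx (frechet Q) f p - op_apply TDx (frechet Q) f p) /\
         (forall p,
            op_apply TDx2 (op_lift (op_subst_ux D0))
              (fun q => u_t q - lift (subst_ux (Euler H1)) q) p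
            = Euler2 (fun q => lift Q q * u_t q + lift (subst_ux H2) q) p)).
Proof.
  intros H0 H1 H2 D0 _ HH1 HH2 _ _ HE2.
  pose proof (potential_gradient H1 H2 D0 HH1 HH2 HE2) as Hgrad.
  split; [exact Hgrad|]; intros Hsymp.
  set (A := op_subst_ux D0) in *; set (F := subst_ux (Euler H1)) in *.
  set (G := subst_ux H2) in *.
  assert (HF : dfun F) by (now apply dfun_subst, dfun_Euler).
  assert (HG : dfun G) by (now apply dfun_subst).
  clearbody A F G.
  destruct (symplectic_potential A Hsymp) as [Q [N [HQ [HNQ [HN Hcoef]]]]].
  assert (HA : dop_wf A) by apply Hsymp.
  assert (HwQ : dop_wf (DOp N (fun j => partial (U j) Q))) by (intros j _; now apply dfun_partial).
  assert (Hop : forall f, dfun f -> forall p, op_apply TDx A f p =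
            op_adjoint TDx (frechet Q) f p - op_apply TDx (frechet Q) f p).
  { intros f Hf p; rewrite (frechet_apply Q N), (frechet_adjoint Q N) by easy.
    rewrite (op_adjoint_normal _ _ TDx_derivation N) by easy.
    unfold op_apply; rewrite (sum_cut A _ N), <- minus_sum by easy.
    apply sum_eq; intros i Hi; rewrite Hcoef by easy; unfold fadd, fopp; ring. }
  assert (Hvar : forall p, op_apply TDx2 (op_lift A) (fun q => u_t q - lift F q) p =
            Euler2 (lagrangian Q G) p).
  { intros p; rewrite (Euler2_lagrangian Q G N) by easy.
    assert (Hsplit : op_apply TDx2 (op_lift A) (fun q => u_t q - lift F q) p =
              op_apply TDx2 (op_lift A) u_t p - lift (op_apply TDx A F) p).
    { change (lift (op_apply TDx A F) p) with (sum_f_R0 (fun i =>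
        lift (op_coef A i) p * lift (Nat.iter i TDx F) p) (op_order A)).
      unfold op_apply at 1 2; simpl op_order; simpl op_coef; rewrite <- minus_sum.
      apply sum_eq; intros i Hi.
      change (fun q => u_t q - lift F q) with (fadd u_t (fopp (lift F))).
      pose proof (dfun_lift F HF) as HlF.
      rewrite (iter_add _ _ TDx2_derivation), (iter_opp _ _ TDx2_derivation)
        by (auto using dfun_opp, dfun_u_t).
      rewrite iter_TDx2_lift by easy; unfold fadd, fopp, lift; ring. }
    rewrite Hsplit.
    replace (lift (op_apply TDx A F) p) with (- lift (Euler G) p)
      by (unfold lift; rewrite Hgrad; reflexivity).
    assert (Hlin : op_apply TDx2 (op_lift A) u_t p =
              op_adjoint TDx2 (DOp N (fun i => lift (partial (U i) Q))) u_t p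
              - op_apply TDx2 (DOp N (fun i => lift (partial (U i) Q))) u_t p).
    { rewrite (op_adjoint_normal _ _ TDx2_derivation N); [| |apply dfun_u_t|easy].
      2: { intros j _; now apply dfun_lift, dfun_partial. }
      pose (p1 := fun c => match c with X => p X2 | U i => p (W 0 i) end).
      change (op_apply TDx2 (op_lift A) u_t p) with
        (sum_f_R0 (fun i => op_coef A i p1 * Nat.iter i TDx2 u_t p) (op_order A)).
      unfold op_apply; simpl op_order; simpl op_coef.
      rewrite (sum_cut A (fun i => Nat.iter i TDx2 u_t p) N) by easy.
      rewrite <- minus_sum; apply sum_eq; intros i Hi; rewrite Hcoef by easy.
      unfold op_adj_coef, fadd, fopp, fsum; simpl.
      rewrite (sum_eq (fun j => adj_coef TDx2 j (lift _) i p)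
        (fun j => lift (adj_coef TDx j (partial (U j) Q) i) p)).
      - unfold p1, lift; ring.
      - intros j _; now rewrite adj_coef_lift by now apply dfun_partial. }
    rewrite Hlin; ring. }
  split.
  - split; [|split].
    + intros i Hi; now apply dfun_lift, HA.
    + intros i _ p q _ HX HW; simpl; unfold lift; f_equal.
      apply functional_extensionality; intros [|j]; auto.
    + exists (lagrangian Q G); split; [now apply dfun_lagrangian | exact Hvar].
  - exists Q; split; [easy|]; split; [exact Hop | exact Hvar].
Qed.
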